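(* Let $Q(\underline{x}) = x_1^2 + 2x_2^2 - x_3^2$ and $F=\{\underline{x}\in\mathbb{Z}^3 : x_1,x_2,x_3>0\}$. Then: (1) The three matrices $$N_1=\begin{bmatrix}0&-2&1\\1&-1&1\\1&-2&2\end{bmatrix},\quad N_2=\begin{bmatrix}0&2&1\\1&1&1\\1&2&2\end{bmatrix},\quad N_3=\begin{bmatrix}0&2&1\\-1&1&1\\-1&2&2\end{bmatrix}$$ together with the base triple $(1,2,3)^T$ form a matrix generating system for the primitive solutions of $Q(\underline x)=0$ in $F$, with the additional restriction that $N_1$, applied to a solution $(x_1,x_2,x_3)^T\in F$, produces a solution with all entries positive if and only if $x_1>x_3/\sqrt2$. (2) Under the conjugacy map $\pi(x,y)=\frac{y}{x+1}$, the 1-dimensional dynamical system corresponding to this generating system is the map on $(0,1/\sqrt2)$ (defined off finitely many points) $$T_4(t)=\begin{cases}\frac{t}{1-2t}& t\in\left(0,\frac{1}{2+\sqrt2}\right),\\ \frac{1}{2t}-1& t\in\left(\frac{1}{2+\sqrt2},\frac12\right),\\ 1-\frac{1}{2t}& t\in\left(\frac12,\frac{1}{\sqrt2}\right).\end{cases}$$ (3) The measure $$d\mu=\left(\mathbf{1}_{(0,\,1/(2+\sqrt2))}(t)\cdot\frac{1}{t(1-t)}+\mathbf{1}_{(1/(2+\sqrt2),\,1/\sqrt2)}(t)\cdot\frac1t\right)dt$$ on $(0,1/\sqrt2)$ is $\sigma$-finite, $T_4$-invariant, ergodic and conservative.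
   Context: A solution $(a,b,c)^T\in\mathbb{Z}^3$ of $Q=0$ is primitive if $a,b,c$ have no common divisor greater than $1$. Matrix generating system with the restriction: for $\underline v\in F$ with $Q(\underline v)=0$, the vectors $N_2\underline v$ and $N_3\underline v$ are again solutions in $F$, while $N_1\underline v$ lies in $F$ exactly under the condition in the claim, and $N_1$ is only to be applied in that case. The matrices and the base triple $\underline b$ form a matrix generating system if the vectors $N_{a_1}N_{a_2}\cdots N_{a_n}\underline{b}$ ($n\ge0$, $a_j\in\{1,2,3\}$) for which every partial product $N_{a_j}\cdots N_{a_n}\underline b$, $1\le j\le n$, lies in $F$ are exactly the primitive solutions of $Q=0$ in $F$, and every primitive solution in $F$ has exactly one such representation. Corresponding 1-dimensional system: let $\mathcal{E}=\{(x,y)\in\mathbb{R}^2: Q(x,y,1)=0\}$ and let $FA\subset\mathcal{E}$ be the arc of points $(x,y)$ with $x,y>0$. A matrix $A$ preserving $Q$ acts on points $(x,y)$ of $\mathcal{E}$ by $\widehat{A}(x,y)=(v_1/v_3,v_2/v_3)$ where $(v_1,v_2,v_3)^T=A(x,y,1)^T$. Put $\mathcal{D}_i=FA\cap\widehat{N_i}(FA)$; these sets are pairwise disjoint and cover $FA$ up to finitely many points. The system is the map $\widehat{T}$ on $FA$ (defined off finitely many points) given by $\widehat T=\widehat{N_i^{-1}}$ on $\mathcal{D}_i$. That $T_4$ is this system under the conjugacy map $\pi$ means that $\pi: FA\to(0,1/\sqrt2)$ is a homeomorphism and $T_4=\pi\circ\widehat T\circ\pi^{-1}$ off finitely many points.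 $\mathbf 1_A$ is the indicator function of $A$. A measure $\mu$ is $T$-invariant if $\mu(T^{-1}A)=\mu(A)$ for all Borel $A$; ergodic if $T^{-1}A=A$ implies $\mu(A)=0$ or $\mu(A^c)=0$; conservative if there is no set $W$ of positive measure with $W,T^{-1}W,T^{-2}W,\dots$ pairwise disjoint. Statements about $T$ are understood off the Lebesgue-null set of points where some iterate is undefined. *)

(* Defs.v *)
From HB Require Import structures.
From mathcomp Require Export all_boot all_order all_algebra.
From mathcomp Require Export all_classical all_reals all_analysis.
From mathcomp Require Export measurable_realfun.
Import Order.TTheory GRing.Theory Num.Theory.
Import numFieldNormedType.Exports.

Set Implicit Arguments.
Unset Strict Implicit.
Unset Printing Implicit Defensive.

Local Open Scope classical_set_scope.
Local Open Scope ring_scope.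

(** * The quadratic form and integer solutions *)

Definition vec3 (A : Type) (a b c : A) : 'cV[A]_3 :=
  \col_(i < 3) nth a [:: a; b; c] i.

Definition mat3 (A : Type) (r1 r2 r3 : 'cV[A]_3) : 'M[A]_3 :=
  \matrix_(i < 3, j < 3) nth r1 [:: r1; r2; r3] i j 0.

Definition Q (A : pzRingType) (v : 'cV[A]_3) : A :=
  v 0 0 ^+ 2 + 2%:R * v 1 0 ^+ 2 - v 2%:R 0 ^+ 2.

Definition F : set 'cV[int]_3 := [set v | forall i, 0 < v i 0].

Definition primitive (v : 'cV[int]_3) : Prop :=
  ~ exists d : int, 1 < d /\ forall i, (d %| (v i 0)%R)%Z.

(** * Matrix generating systems *)

(* The word [:: a_1; ...; a_n] stands for N_{a_1} ... N_{a_n} b. *)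
Definition word_act (I : Type) (N : I -> 'M[int]_3) (b : 'cV[int]_3)
    (w : seq I) : 'cV[int]_3 :=
  foldr (fun a v => N a *m v) b w.

(* [drop j [:: a_1; ...; a_n]] is [:: a_{j+1}; ...; a_n]. *)
Definition admissible (I : Type) (N : I -> 'M[int]_3) (b : 'cV[int]_3)
    (P : set 'cV[int]_3) (w : seq I) : Prop :=
  forall j, (j < size w)%N -> P (word_act N b (drop j w)).

Definition matrix_generating_system (I : Type) (N : I -> 'M[int]_3)
    (b : 'cV[int]_3) (q : 'cV[int]_3 -> int) (P : set 'cV[int]_3) : Prop :=
  let sols := [set v | [/\ P v, q v = 0 & primitive v]] in
  word_act N b @` [set w | admissible N b P w] = sols /\
  (forall v, sols v -> exists! w, admissible N b P w /\ word_act N b w = v).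

Definition N1 : 'M[int]_3 :=
  mat3 (vec3 0 (-2) 1) (vec3 1 (-1) 1) (vec3 1 (-2) 2).
Definition N2 : 'M[int]_3 :=
  mat3 (vec3 0 2 1) (vec3 1 1 1) (vec3 1 2 2).
Definition N3 : 'M[int]_3 :=
  mat3 (vec3 0 2 1) (vec3 (-1) 1 1) (vec3 (-1) 2 2).

(* N_1, N_2, N_3 are indexed by 0, 1, 2 : 'I_3. *)
Definition N (i : 'I_3) : 'M[int]_3 := nth N1 [:: N1; N2; N3] i.

Definition base : 'cV[int]_3 := vec3 1 2 3.

(** * The corresponding one-dimensional system *)

Definition NR (R : realType) (i : 'I_3) : 'M[R]_3 := map_mx intr (N i).

Definition conic (R : realType) : set (R * R) :=
  [set p | Q (vec3 p.1 p.2 1) = 0].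

Definition FA (R : realType) : set (R * R) :=
  [set p | conic p /\ (0 < p.1 /\ 0 < p.2)].

Definition hat (R : realType) (A : 'M[R]_3) (p : R * R) : R * R :=
  let v := A *m vec3 p.1 p.2 1 in (v 0 0 / v 2%:R 0, v 1 0 / v 2%:R 0).

Definition cyl (R : realType) (i : 'I_3) : set (R * R) :=
  @FA R `&` hat (NR R i) @` @FA R.
Arguments cyl : clear implicits.

(* The junk value p is only taken outside That_dom; the choice made by [pick]
   is unambiguous as soon as the sets [cyl R i] are pairwise disjoint. *)
Definition That (R : realType) (p : R * R) : R * R :=
  if [pick i | p \in cyl R i] is Some i then hat (invmx (NR R i)) p else p.

Definition That_dom (R : realType) : set (R * R) := \bigcup_i cyl R i.

Definition pi4 (R : realType) (p : R * R) : R := p.2 / (p.1 + 1).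

Definition homeomorphism (X Y : topologicalType) (A : set X) (B : set Y)
    (f : X -> Y) (g : Y -> X) : Prop :=
  [/\ (forall x, A x -> B (f x) /\ g (f x) = x),
      (forall y, B y -> A (g y) /\ f (g y) = y),
      {within A, continuous f} & {within B, continuous g}].

Definition I4 (R : realType) : set R := `]0, (Num.sqrt 2)^-1[.

Definition T4_dom (R : realType) : set R :=
  `]0, (2 + Num.sqrt 2)^-1[ `|` `](2 + Num.sqrt 2)^-1, 2^-1[
    `|` `]2^-1, (Num.sqrt 2)^-1[.

(* Only meaningful on T4_dom. *)
Definition T4 (R : realType) (t : R) : R :=
  if t < (2 + Num.sqrt 2)^-1 then t / (1 - 2 * t)
  else if t < 2^-1 then 1 / (2 * t) - 1
  else 1 - 1 / (2 * t).

(** * Ergodic theory of maps defined almost everywhere *)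

Definition always_defined (X : Type) (D : set X) (T : X -> X) : set X :=
  [set x | forall n, D (iter n T x)].

(* In the following definitions the phase space is the set D. *)
Definition invariant_measure (d : measure_display) (X : measurableType d)
    (R : realType) (mu : {measure set X -> \bar R}) (D : set X)
    (T : X -> X) : Prop :=
  measurable_fun D T /\
  forall A, measurable A -> A `<=` D -> mu (D `&` T @^-1` A) = mu A.

Definition ergodic (d : measure_display) (X : measurableType d)
    (R : realType) (mu : {measure set X -> \bar R}) (D : set X)
    (T : X -> X) : Prop :=
  forall A, measurable A -> A `<=` D -> D `&` T @^-1` A = A ->
    mu A = 0%E \/ mu (D `\` A) = 0%E.

Definition conservative (d : measure_display) (X : measurableType d)
    (R : realType) (mu : {measure set X -> \bar R}) (D : set X)
    (T : X -> X) : Prop :=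
  ~ exists W, [/\ measurable W, W `<=` D, (0 < mu W)%E &
      trivIset setT (fun n => D `&` iter n T @^-1` W)].

(** * The invariant measure *)

Definition density4 (R : realType) (t : R) : R :=
  \1_(`]0, (2 + Num.sqrt 2)^-1[) t * (t * (1 - t))^-1 +
  \1_(`](2 + Num.sqrt 2)^-1, (Num.sqrt 2)^-1[) t * t^-1.

Definition mu4 (R : realType) (A : set (measurableTypeR R)) : \bar R :=
  (\int[@lebesgue_measure R]_(t in A) (density4 t)%:E)%E.

Lemma cut4_gt0 (R : realType) : 0 < (2 + Num.sqrt 2)^-1 :> R.
Proof. by rewrite invr_gt0 ltr_pwDl// sqrtr_ge0. Qed.

Lemma cut4_lt1 (R : realType) : (2 + Num.sqrt 2)^-1 < 1 :> R.
Proof.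
rewrite invf_lt1; last by rewrite ltr_pwDl// sqrtr_ge0.
by rewrite (@lt_le_trans _ _ 2) ?ltr1n// lerDl sqrtr_ge0.
Qed.

Lemma density4_ge0 (R : realType) (t : R) : 0 <= density4 t.
Proof.
rewrite /density4 !indicE !mem_setE !in_itv/=.
apply: addr_ge0.
  case: andP => [[t0 ta]|_]; last by rewrite mul0r.
  rewrite mul1r invr_ge0 mulr_ge0 ?ltW//.
  by rewrite subr_gt0 (lt_trans ta)// cut4_lt1.
case: andP => [[at0 _]|_]; last by rewrite mul0r.
by rewrite mul1r invr_ge0 ltW// (lt_trans _ at0)// cut4_gt0.
Qed.

Lemma measurable_invr (R : realType) :
  measurable_fun setT (fun t : R => t^-1).
Proof.
have -> : [set: R] = [set 0] `|` ~` [set 0] by rewrite setUv.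
apply/measurable_funU; [exact: measurable_set1| |].
  by apply: measurableC; exact: measurable_set1.
split; first exact: measurable_fun_set1.
apply: open_continuous_measurable_fun.
  by apply: closed_openC; exact: closed_eq.
by move=> x /set_mem/eqP x0; exact: inv_continuous.
Qed.

Lemma measurable_density4 (R : realType) : measurable_fun setT (@density4 R).
Proof.
apply: measurable_funD; apply: measurable_funM.
- exact: measurable_indic.
- apply: (measurableT_comp (@measurable_invr R)).
  by apply: measurable_funM => //; exact: measurable_funB.
- exact: measurable_indic.
- exact: measurable_invr.
Qed.

Lemma mu4_set0 (R : realType) : @mu4 R set0 = 0%E.
Proof. by rewrite /mu4 integral_set0. Qed.

Lemma mu4_ge0 (R : realType) A : (0 <= @mu4 R A)%E.
Proof. by apply: integral_ge0 => t _; rewrite lee_fin density4_ge0. Qed.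

Lemma mu4_semi_sigma_additive (R : realType) : semi_sigma_additive (@mu4 R).
Proof.
move=> /= G mG tG mUG; rewrite /mu4; apply: cvg_toP.
  apply: ereal_nondecreasing_is_cvgn => m n mn.
  apply: lee_sum_nneg_natr => // k _ _; apply: integral_ge0 => /= x _.
  by rewrite lee_fin density4_ge0.
rewrite ge0_integral_bigcup//=.
- apply/measurable_funTS/measurableT_comp => //.
  exact: measurable_density4.
- by move=> x _; rewrite lee_fin density4_ge0.
Qed.

HB.instance Definition _ (R : realType) :=
  isMeasure.Build _ _ _ (@mu4 R)
    (@mu4_set0 R) (@mu4_ge0 R) (@mu4_semi_sigma_additive R).

(* Main.v *)
Require Import Defs.
From mathcomp Require Import ring lra zify.
Import Order.TTheory GRing.Theory Num.Theory.
Import numFieldNormedType.Exports.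
Local Open Scope classical_set_scope.
Local Open Scope ring_scope.

(** Since [N i] is [N2] times a diagonal sign matrix, its inverse sends
    (x, y, z) to (s (2 y - z), e (x + y - z), 2 z - x - 2 y) with signs s, e
    depending on [i].  On positive solutions the last entry is positive and
    smaller than z, so the signs of 2 y - z and x + y - z single out the only
    possible last letter, and the descent stops exactly when x + y = z, at the
    base triple.  The same signs, read on the conic, give the branches of [T4].

    Invariance is checked on the half-lines above p > 0, whose preimages are
    unions of intervals of explicit measure.

    Ergodicity and conservativity both follow from the fact that almost every
    point visits a given set E of positive measure at arbitrarily large times.
    Each x lies in the image of arbitrarily strongly contracting Moebius inverse
    branches of iterates of [T4] with uniformly bounded distortion, obtained by
    inducing outside the neighbourhood of the indifferent fixed point 0.  Hence
    the points visiting E have positive lower density at every x, and Lebesgue's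
    density theorem applies. *)

Set Implicit Arguments.
Unset Strict Implicit.
Unset Printing Implicit Defensive.

(** * The matrices N i *)

Lemma vec3_coords (A : Type) (v : 'cV[A]_3) :
  v = vec3 (v 0 0) (v 1 0) (v 2%:R 0).
Proof.
apply/colP => i; rewrite mxE.
by case: i => [[|[|[|//]]] i] /=; congr (v _ _); exact: val_inj.
Qed.

Lemma vec3E (A : Type) (a b c : A) :
  (vec3 a b c 0 0 = a) * (vec3 a b c 1 0 = b) * (vec3 a b c 2%:R 0 = c).
Proof. by rewrite !mxE. Qed.

Lemma mat3_mul (A : pzRingType) (r1 r2 r3 v : 'cV[A]_3) :
  mat3 r1 r2 r3 *m v =
  let dot (r : 'cV[A]_3) := r 0 0 * v 0 0 + r 1 0 * v 1 0 + r 2%:R 0 * v 2%:R 0 in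
  vec3 (dot r1) (dot r2) (dot r3).
Proof.
have dotE (r : 'cV[A]_3) : \sum_(j < 3) r j 0 * v j 0 =
    r 0 0 * v 0 0 + r 1 0 * v 1 0 + r 2%:R 0 * v 2%:R 0.
  by rewrite !big_ord_recl big_ord0 addr0 addrA; congr (_ * _ + _ * _ + _ * _);
    congr fun_of_matrix; exact: val_inj.
apply/colP => i; rewrite /= -!dotE !mxE.
under eq_bigr do rewrite mxE.
by case: i => [[|[|[|//]]] i].
Qed.

(* [N i] is [N2] times the diagonal matrix (xsign i, ysign i, 1). *)
Definition xsign (A : pzRingType) (i : 'I_3) : A := if i == 2%:R then -1 else 1.
Definition ysign (A : pzRingType) (i : 'I_3) : A := if i == 0 then -1 else 1.
Arguments xsign {A} i.
Arguments ysign {A} i.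

Lemma xsignK (A : pzRingType) i : involutive ( *%R (xsign i : A)).
Proof. by move=> a; rewrite /xsign; case: ifP; rewrite ?mulN1r ?opprK ?mul1r. Qed.
Lemma ysignK (A : pzRingType) i : involutive ( *%R (ysign i : A)).
Proof. by move=> a; rewrite /ysign; case: ifP; rewrite ?mulN1r ?opprK ?mul1r. Qed.

Lemma map_mat3 (A B : Type) (f : A -> B) r1 r2 r3 :
  map_mx f (mat3 r1 r2 r3) = mat3 (map_mx f r1) (map_mx f r2) (map_mx f r3).
Proof.
apply/matrixP => i j; rewrite !mxE.
by case: i => [[|[|[|//]]] i] /=; rewrite !mxE.
Qed.

Lemma map_vec3 (A B : Type) (f : A -> B) a b c :
  map_mx f (vec3 a b c) = vec3 (f a) (f b) (f c).
Proof.
by apply/colP => i; rewrite !mxE; case: i => [[|[|[|//]]] i].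
Qed.

Lemma mapN_mul (A : comNzRingType) i (v : 'cV[A]_3) :
  let x := xsign i * v 0 0 in let y := ysign i * v 1 0 in let z := v 2%:R 0 in
  map_mx intr (N i) *m v = vec3 (2 * y + z) (x + y + z) (x + 2 * y + 2 * z).
Proof.
case: i => [[|[|[|//]]] i] /=; rewrite /N /= /N1 /N2 /N3 map_mat3 !map_vec3;
  rewrite mat3_mul /= !vec3E /xsign /ysign /=; congr vec3;
  rewrite ?intr0 ?intr1; ring.
Qed.

(** The diagonal sign matrix of [i] times the inverse of [N2]. Written out over any ring, it serves
    the integer descent and the real system alike. *)
Definition Ninv (A : pzRingType) (i : 'I_3) : 'M[A]_3 :=
  mat3 (vec3 0 (2 * xsign i) (- xsign i))
       (vec3 (ysign i) (ysign i) (- ysign i)) (vec3 (-1) (-2) 2).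

Lemma Ninv_mul (A : comNzRingType) i (v : 'cV[A]_3) :
  let x := v 0 0 in let y := v 1 0 in let z := v 2%:R 0 in
  Ninv A i *m v =
  vec3 (xsign i * (2 * y - z)) (ysign i * (x + y - z)) (2 * z - x - 2 * y).
Proof. by rewrite mat3_mul /= !vec3E; congr vec3; ring. Qed.

Lemma N_Ninv_mul (A : comNzRingType) i (v : 'cV[A]_3) :
  map_mx intr (N i) *m (Ninv A i *m v) = v.
Proof.
rewrite mapN_mul Ninv_mul !vec3E !xsignK !ysignK [RHS]vec3_coords.
by congr vec3; ring.
Qed.

Lemma Ninv_N_mul (A : comNzRingType) i (v : 'cV[A]_3) :
  Ninv A i *m (map_mx intr (N i) *m v) = v.
Proof.
rewrite mapN_mul Ninv_mul !vec3E [RHS]vec3_coords.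
congr vec3; last by ring.
- by rewrite -[RHS](xsignK i); congr (_ * _); ring.
- by rewrite -[RHS](ysignK i); congr (_ * _); ring.
Qed.

Lemma mapN_int i : map_mx intr (N i) = N i :> 'M[int]_3.
Proof. by apply/matrixP => a b; rewrite mxE intz. Qed.

(** Squaring removes the signs, so one polynomial identity covers the three matrices. *)
Lemma Q_mapN (A : comNzRingType) i (v : 'cV[A]_3) :
  Q (map_mx intr (N i) *m v) = Q v.
Proof.
rewrite mapN_mul /Q !vec3E.
have -> : v 0 0 ^+ 2 = (xsign i * v 0 0) ^+ 2.
  by rewrite exprMn !expr2 -mulrA xsignK.
have -> : v 1 0 ^+ 2 = (ysign i * v 1 0) ^+ 2.
  by rewrite exprMn !expr2 -mulrA ysignK.
by ring.
Qed.

(** * Descent on integer solutions *)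

Lemma F_coords (v : 'cV[int]_3) :
  F v <-> [/\ 0 < v 0 0, 0 < v 1 0 & 0 < v 2%:R 0].
Proof.
split=> [Fv|[x0 y0 z0]]; first by split; exact: Fv.
by move=> i; rewrite [v]vec3_coords mxE; case: i => [[|[|[|//]]] i].
Qed.

Lemma Q_eq0 (A : pzRingType) (v : 'cV[A]_3) :
  Q v = 0 -> v 0 0 ^+ 2 + 2 * v 1 0 ^+ 2 = v 2%:R 0 ^+ 2.
Proof. by move/eqP; rewrite subr_eq0 => /eqP. Qed.

Lemma Q_N i (v : 'cV[int]_3) : Q (N i *m v) = Q v.
Proof. by rewrite -[N i]mapN_int Q_mapN. Qed.

(** The inverse of [N i] is integral as well, so a common divisor of the entries of [N i *m v]
    divides those of [v]. *)
Lemma primitive_N i v : primitive v -> primitive (N i *m v).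
Proof.
move=> pv [d [d1 dNv]]; apply: pv; exists d; split=> // k.
by rewrite -[v](Ninv_N_mul i) mapN_int mxE; apply: rpred_sum => j _; exact: dvdz_mull.
Qed.

Lemma primitive_N_inv i v : primitive (N i *m v) -> primitive v.
Proof.
move=> pv [d [d1 dNv]]; apply: pv; exists d; split=> // k.
by rewrite mxE; apply: rpred_sum => j _; exact: dvdz_mull.
Qed.

(** Compare squares: [(x+2y)^2 - z^2 = 4xy + 2y^2] and [4z^2 - (x+2y)^2 = 2x^2 + (x-2y)^2]. The last
    two bounds place [2z - x - 2y], the third entry after a descent step, strictly between 0 and
    [z]. *)
Lemma form_bounds (x y z : int) : 0 < x -> 0 < y -> 0 < z ->
  x ^+ 2 + 2 * y ^+ 2 = z ^+ 2 ->
  [/\ x < z, y < z, z < x + 2 * y & x + 2 * y < 2 * z].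
Proof.
move=> x0 y0 z0 xyz.
have lt_sqr (a b : int) : 0 < a -> 0 < b -> a ^+ 2 < b ^+ 2 -> a < b.
  by move=> a0 b0; rewrite ltr_pXn2r// nnegrE ltW.
have xx := mulr_gt0 x0 x0; have xy := mulr_gt0 x0 y0; have yy := mulr_gt0 y0 y0.
have x2y : 0 <= (x - 2 * y) * (x - 2 * y) by exact: sqr_ge0.
by split; apply: lt_sqr => //; rewrite ?expr2 in xyz *; lia.
Qed.

(** The exponent of 2 is even on the left and odd on the right. *)
Lemma sqr_neq_double_sqr (x y : int) : 0 < x -> 0 < y -> x ^+ 2 <> 2 * y ^+ 2.
Proof.
move=> x0 y0 /(congr1 absz); rewrite abszM !abszX /= => /(congr1 (logn 2)).
rewrite lognM ?expn_gt0 ?absz_gt0 ?gt_eqF// !lognX [logn 2 _ in RHS]/= add1n.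
by move/(congr1 odd); rewrite !mul2n /= !odd_double.
Qed.

Definition solution (v : 'cV[int]_3) : Prop := [/\ F v, Q v = 0 & primitive v].

Lemma solution_base : solution base.
Proof.
split; first by apply/F_coords; rewrite !vec3E.
- by rewrite /Q !vec3E.
- by move=> [d [d1 /(_ 0)]]; rewrite vec3E dvdz1; lia.
Qed.

Lemma admissible_cons i w : admissible N base F (i :: w) <->
  F (N i *m word_act N base w) /\ admissible N base F w.
Proof.
split=> [adm|[Fw adm] [|j]//]; last exact: adm.
by split; [exact: (adm 0%N)|move=> j jw; exact: (adm j.+1)].
Qed.

Lemma admissible_solution w : admissible N base F w ->
  solution (word_act N base w).
Proof.
elim: w => [_|i w IHw /admissible_cons[Fw /IHw[_ Qw pw]]]; first exact: solution_base.
by split=> //=; [rewrite Q_N|exact: primitive_N].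
Qed.

Lemma Ninv_N i (v : 'cV_3) : Ninv int i *m (N i *m v) = v.
Proof. by rewrite -[N i]mapN_int Ninv_N_mul. Qed.

Lemma N_Ninv i (v : 'cV_3) : N i *m (Ninv int i *m v) = v.
Proof. by rewrite -[N i]mapN_int N_Ninv_mul. Qed.

(** For the indices 0, 1, 2 the sign pairs are (1,-1), (1,1), (-1,1), which are distinct. This
    yields both the uniqueness of the descent and the disjointness of the cylinders. *)
Lemma sign_eq (A : realDomainType) (i j : 'I_3) (a b : A) :
  0 < xsign i * a -> 0 < ysign i * b -> 0 < xsign j * a -> 0 < ysign j * b ->
  i = j.
Proof.
rewrite /xsign /ysign.
case: i => [[|[|[|//]]] i]; case: j => [[|[|[|//]]] j] /=;
  rewrite ?mulN1r ?mul1r => *; first [exact: val_inj | exfalso; lra].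
Qed.

Lemma N_index_inj i j (u v : 'cV_3) : F u -> F v -> N i *m u = N j *m v -> i = j.
Proof.
move=> /F_coords[x0 y0 _] /F_coords[x0' y0' _] uv.
have uE := Ninv_N i u; have vE := Ninv_N j v; rewrite -uv in vE.
move: x0 y0 x0' y0'; rewrite -uE -vE !Ninv_mul !vec3E; exact: sign_eq.
Qed.

(** Up to sign, the second entry of [Ninv int i *m base] is [1 + 2 - 3 = 0], so no predecessor of
    the base triple is positive. *)
Lemma base_not_N i u : F u -> N i *m u <> base.
Proof.
move=> Fu Nu; have := Fu 1; rewrite -(Ninv_N i u) Nu Ninv_mul !vec3E.
by rewrite mulr0.
Qed.

Lemma admissible_word_inj w w' : admissible N base F w -> admissible N base F w' ->
  word_act N base w = word_act N base w' -> w = w'.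
Proof.
elim: w w' => [|i w IHw] [|j w'] //.
- move=> _ /admissible_cons[_ /admissible_solution[Fw _ _]] /esym.
  by move/(base_not_N Fw).
- by move=> /admissible_cons[_ /admissible_solution[Fw _ _]] _ /(base_not_N Fw).
move=> /admissible_cons[_ aw] /admissible_cons[_ aw'] /= ww'.
have [Fw _ _] := admissible_solution aw.
have [Fw' _ _] := admissible_solution aw'.
have ij := N_index_inj Fw Fw' ww'; subst j; congr cons.
apply: IHw => //.
by rewrite -[LHS](Ninv_N i) ww' Ninv_N.
Qed.

Lemma solution_cases v : solution v ->
  v = base \/ exists i, F (Ninv int i *m v).
Proof.
move=> [/F_coords[x0 y0 z0] /Q_eq0 Qv pv].
have [xz yz zxy xyz] := form_bounds x0 y0 z0 Qv.
set x := v 0 0 in x0 Qv xz zxy xyz; set y := v 1 0 in y0 Qv yz zxy xyz.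
set z := v 2%:R 0 in z0 Qv xz yz zxy xyz.
(* On solutions [y = 2x] is equivalent to [z = x + y]; then [v] is [x] times the base triple, and
   primitivity forces [x = 1]. *)
have [yx|yx] := eqVneq y (2 * x).
  left; have zx : z = 3 * x by nia.
  rewrite [v]vec3_coords -/x -/y -/z yx zx.
  suff -> : x = 1 by [].
  apply/eqP/negPn/negP => x1; apply: pv; exists x; split; first by lia.
  move=> k; rewrite [v]vec3_coords -/x -/y -/z yx zx mxE.
  by case: k => [[|[|[|//]]] ?] /=; rewrite ?dvdz_mull.
(* Otherwise [x^2 = 2y^2]. *)
have zy : z <> 2 * y.
  by move=> zy; apply: (@sqr_neq_double_sqr x y) => //; nia.
have zxy' : z <> x + y by move=> zE; nia.
right.
suff [i [xi yi]] : exists i : 'I_3,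
    0 < xsign i * (2 * y - z) /\ 0 < ysign i * (x + y - z).
  by exists i; apply/F_coords; rewrite Ninv_mul !vec3E -/x -/y -/z; split=> //; lia.
(* Two negative signs cannot occur together: [2y < z] gives [x^2 > 2y^2], hence [y < 2x] and
   [z < x + y]. *)
have [zlty|ylez] := ltP z (2 * y); last first.
  by exists 2%:R; rewrite /xsign /ysign /=; nia.
have [?|?] := ltP z (x + y).
  by exists 1; rewrite /xsign /ysign /=; lia.
by exists 0; rewrite /xsign /ysign /=; lia.
Qed.

(** Induction on a bound for the third entry, which every descent step lowers. *)
Lemma solution_reached v : solution v ->
  exists2 w, admissible N base F w & word_act N base w = v.
Proof.
have [n vn] := ubnP (absz (v 2%:R 0)).
elim: n v vn => [|n IHn] v vn sv.
  by case: sv => /F_coords[_ _ z0]; lia.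
have [->|[i Fi]] := solution_cases sv; first by exists [::].
have [Fv Qv pv] := sv.
pose u := Ninv int i *m v.
have Niu : N i *m u = v by rewrite N_Ninv.
have [||w aw wu] := IHn u.
- have /F_coords[x0 y0 z0] := Fv.
  have [_ _ zxy _] := form_bounds x0 y0 z0 (Q_eq0 Qv).
  move: Fi vn zxy => /F_coords[_ _]; rewrite /u Ninv_mul !vec3E.
  by move: (v 0 0) (v 1 0) (v 2%:R 0) => x y z; lia.
- split=> //; first by rewrite -(Q_N i) Niu.
  by apply: (@primitive_N_inv i); rewrite Niu.
exists (i :: w); last by rewrite /= wu Niu.
by apply/admissible_cons; rewrite wu Niu.
Qed.

Lemma generating_system : matrix_generating_system N base (@Q int) F.
Proof.
split.
  apply/seteqP; split=> [_ [w aw <-]|v sv]; first exact: admissible_solution.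
  by have [w ? ?] := solution_reached sv; exists w.
move=> v sv; have [w aw wv] := solution_reached sv.
exists w; split=> // w' [aw' w'v].
by apply: admissible_word_inj => //; rewrite wv w'v.
Qed.

Lemma N_restriction (R : realType) (v : 'cV[int]_3) : F v -> Q v = 0 ->
  [/\ F (N2 *m v) /\ Q (N2 *m v) = 0, F (N3 *m v) /\ Q (N3 *m v) = 0,
      Q (N1 *m v) = 0 &
      F (N1 *m v) <-> (v 2%:R 0)%:~R / Num.sqrt 2 < (v 0 0)%:~R :> R].
Proof.
move=> /F_coords[x0 y0 z0] Qv.
have Qv' := Q_eq0 Qv; have [xz yz zxy xyz] := form_bounds x0 y0 z0 Qv'.
split.
- split; last by rewrite (Q_N 1 v).
  rewrite -[N2](mapN_int 1) mapN_mul.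
  by apply/F_coords; rewrite !vec3E /xsign /ysign /=; split; lia.
- split; last by rewrite (Q_N 2%:R v).
  rewrite -[N3](mapN_int 2%:R) mapN_mul.
  by apply/F_coords; rewrite !vec3E /xsign /ysign /=; split; lia.
- by rewrite (Q_N 0 v).
(* Only the first entry [z - 2y] of [N1 *m v] can fail to be positive. *)
have -> : F (N1 *m v) <-> 2 * v 1 0 < v 2%:R 0.
  rewrite -[N1](mapN_int 0) mapN_mul; split.
    by move=> /F_coords[+ _ _]; rewrite !vec3E /ysign /=; lia.
  by move=> yz'; apply/F_coords; rewrite !vec3E /xsign /ysign /=; split; lia.
(* Square, and substitute [2y^2 = z^2 - x^2]. *)
have -> : 2 * v 1 0 < v 2%:R 0 <-> (v 2%:R 0) ^+ 2 < 2 * (v 0 0) ^+ 2.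
  rewrite -(@ltr_pXn2r _ 2) ?nnegrE ?mulr_ge0 ?ltW// -Qv' !expr2.
  by move: (v 0 0) (v 1 0) => x y; split=> ?; lia.
have s2 : 0 < Num.sqrt 2 :> R by rewrite sqrtr_gt0.
rewrite ltr_pdivrMr//.
rewrite -[X in _ <-> is_true X](@ltr_pXn2r _ 2)// ?nnegrE ?mulr_ge0 ?ler0z ?ltW//.
rewrite exprMn sqr_sqrtr// [_ * 2]mulrC.
have -> : 2 * (v 0 0)%:~R ^+ 2 = (2 * v 0 0 ^+ 2)%:~R :> R.
  by rewrite rmorphM rmorphXn.
by rewrite -rmorphXn ltr_int.
Qed.

(** * The conic and its parametrization *)

Section real.
Context {R : realType}.
Implicit Types (t x y : R) (p q : R * R) (v : 'cV[R]_3).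

Local Notation s := (Num.sqrt 2 : R).

(** These facts let [lra] and [nra] treat [s] as an ordinary variable. *)
Lemma sqrt2_bounds : [/\ s * s = 2, 7 / 5 < s & s < 3 / 2].
Proof.
have ss : s * s = 2 by rewrite -expr2 sqr_sqrtr.
have s0 : 0 < s by rewrite sqrtr_gt0.
by split=> //; rewrite ltNge; apply/negP => ?; nra.
Qed.

Lemma invr_sqrt2 : s^-1 = s / 2.
Proof.
have [ss s1 _] := sqrt2_bounds; have s0 : s != 0 by lra.
by apply: (mulfI s0); rewrite mulfV// mulrA ss divff.
Qed.

Lemma cut4E : (2 + s)^-1 = 1 - s / 2.
Proof.
have [ss s1 _] := sqrt2_bounds; have s0 : 2 + s != 0 by lra.
by apply: (mulfI s0); rewrite mulfV//; lra.
Qed.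

(** * Projective action of the matrices on the conic *)

Definition proj v : R * R := (v 0 0 / v 2%:R 0, v 1 0 / v 2%:R 0).

Lemma proj_scale k v : k != 0 -> proj (k *: v) = proj v.
Proof.
by move=> k0; rewrite /proj !mxE !invfM; congr pair; rewrite mulrACA divff// mul1r.
Qed.

Lemma pi4_proj v : v 2%:R 0 != 0 -> pi4 (proj v) = v 1 0 / (v 0 0 + v 2%:R 0).
Proof.
move=> v0; rewrite /pi4 /proj/= -[X in _ + X](divff v0) -mulrDl invf_div.
by rewrite mulrA divfK.
Qed.

Lemma proj_vec3 p : proj (vec3 p.1 p.2 1) = p.
Proof. by rewrite /proj !vec3E !divr1 -surjective_pairing. Qed.

Lemma vec3_proj v : v 2%:R 0 != 0 ->
  vec3 (proj v).1 (proj v).2 1 = (v 2%:R 0)^-1 *: v.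
Proof.
move=> v0; rewrite [in RHS](vec3_coords v) /proj/=.
apply/colP => i; rewrite !mxE.
by case: i => [[|[|[|//]]] i] /=; rewrite ?mulVf// mulrC.
Qed.

(** A point may be represented by any vector with nonzero third entry on its line, so [hat] becomes
    matrix multiplication. *)
Lemma hat_proj (A : 'M[R]_3) v : v 2%:R 0 != 0 -> hat A (proj v) = proj (A *m v).
Proof.
move=> v0; rewrite /hat vec3_proj// -scalemxAr -[LHS]/(proj _) proj_scale//.
by rewrite invr_eq0.
Qed.

Lemma invmx_NR i : invmx (NR R i) = Ninv R i.
Proof.
have NK : NR R i *m Ninv R i = 1%:M.
  apply/matrixP => a b; have /colP/(_ a) := N_Ninv_mul i (delta_mx b 0 : 'cV[R]_3).
  by rewrite mulmxA -colE -[delta_mx _ _]mul1mx -colE [X in X = _]mxE [X in _ = X]mxE.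
have [NU _] := mulmx1_unit NK.
by rewrite -[RHS](mulKmx NU) NK mulmx1.
Qed.

Lemma Q_Ninv i v : Q (Ninv R i *m v) = Q v.
Proof. by rewrite -[in RHS](N_Ninv_mul i v) Q_mapN. Qed.

(** The third expression is the last entry of [Ninv R i] applied to (x, y, 1). It is positive
    because [(x+2y)^2 <= 3] on the conic, by Cauchy-Schwarz. *)
Lemma FA_bounds p : FA p -> [/\ p.1 < 1, p.2 < 3 / 4 & 0 < 2 - p.1 - 2 * p.2].
Proof.
case: p => x y [/Q_eq0]; rewrite !vec3E !expr2 /= => pE [x0 y0].
have xy : 0 <= (x - y) * (x - y) by rewrite -expr2 sqr_ge0.
by split; rewrite ltNge; apply/negP => ?; nra.
Qed.

Lemma FA_proj v : Q v = 0 -> 0 < v 0 0 -> 0 < v 1 0 -> 0 < v 2%:R 0 ->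
  FA (proj v).
Proof.
move=> /Q_eq0 vE v0 v1 v2; split; last by rewrite !divr_gt0.
rewrite /conic /Q /= !vec3E /proj/= expr1n !expr_div_n mulrA -mulrDl vE.
by rewrite divff ?subrr// expf_neq0 ?gt_eqF.
Qed.

(** Up to a positive scalar, [Ninv R i] applied to (x, y, 1) represents the preimage of [p]. Its
    third entry is positive on all of [FA], so only the signs of the first two matter. *)
Lemma cylP i p : cyl R i p <->
  [/\ FA p, 0 < xsign i * (2 * p.2 - 1) & 0 < ysign i * (p.1 + p.2 - 1)].
Proof.
pose w := vec3 p.1 p.2 1.
split=> [[Fp [q Fq qp]]|[Fp xp yp]].
  have [q1 q2 q3] := FA_bounds Fq; have [_ [q10 q20]] := Fq.
  pose v := NR R i *m vec3 q.1 q.2 1.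
  have v2 : 0 < v 2%:R 0.
    rewrite /v /NR mapN_mul !vec3E /xsign /ysign; do 2 case: ifP => _; lra.
  have [k k0 /matrixP wE] : exists2 k, 0 < k & Ninv R i *m w = k *: vec3 q.1 q.2 1.
    exists (v 2%:R 0)^-1; first by rewrite invr_gt0.
    by rewrite /w -qp -[hat _ _]/(proj v) vec3_proj ?gt_eqF// -scalemxAr Ninv_N_mul.
  have := wE 1 0; have := wE 0 0.
  by rewrite Ninv_mul /w !mxE/= => -> ->; split=> //; rewrite mulr_gt0.
have [_ _ p3] := FA_bounds Fp.
split=> //; exists (proj (Ninv R i *m w)).
  by apply: FA_proj; rewrite ?Q_Ninv ?Ninv_mul ?vec3E//; [exact: Fp.1|lra].
rewrite hat_proj; last by rewrite Ninv_mul !vec3E; lra.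
by rewrite N_Ninv_mul proj_vec3.
Qed.

Lemma trivIset_cyl : trivIset setT (cyl R).
Proof.
apply/trivIsetP => i j _ _ /eqP ij; apply/seteqP; split=> // p [].
by move=> /cylP[_ xi yi] /cylP[_ xj yj]; case: ij; exact: sign_eq xi yi xj yj.
Qed.

Lemma That_cyl i p : cyl R i p -> That p = proj (Ninv R i *m vec3 p.1 p.2 1).
Proof.
move=> ip; rewrite /That; case: pickP => [j|/(_ i)]; last by rewrite mem_set.
rewrite inE => jp; suff -> : j = i by rewrite invmx_NR.
move: jp ip => /cylP[_ xj yj] /cylP[_ xi yi]; exact: sign_eq xj yj xi yi.
Qed.

Lemma That_domE p : FA p -> 2 * p.2 != 1 -> p.1 + p.2 != 1 -> That_dom p.
Proof.
move=> Fp px py; have := Fp => -[/Q_eq0]; rewrite !vec3E !expr2 => pE [p1 p2].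
suff [i [xi yi]] : exists i : 'I_3,
    0 < xsign i * (2 * p.2 - 1) /\ 0 < ysign i * (p.1 + p.2 - 1).
  by exists i => //; apply/cylP.
have [x1|x1] := ltP 1 (2 * p.2).
  have [y1|y1] := ltP 1 (p.1 + p.2).
    by exists 1; rewrite /xsign /ysign /=; lra.
  by exists 0; rewrite /xsign /ysign /=; lra.
(* On the conic [x + y <= 1] forces [y >= 2/3], against [2y <= 1]. *)
have y1 : 1 < p.1 + p.2 by rewrite ltNge; apply/negP => ?; nra.
by exists 2%:R; rewrite /xsign /ysign /=; lra.
Qed.

Lemma finite_FA_That_dom : finite_set (@FA R `\` @That_dom R).
Proof.
(* The points where a sign quantity vanishes: [2y = 1], and [x + y = 1], the projection of the base
   triple. *)
apply: (@sub_finite_set _ _ ([set (s / 2, 1 / 2)] `|` [set (1 / 3, 2 / 3)])); last first.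
  by rewrite finite_setU; split; exact: finite_set1.
move=> p [Fp np]; have := Fp => -[/Q_eq0]; rewrite !vec3E !expr2 => pE [p1 p2].
have [ss s1 s2] := sqrt2_bounds.
have [px|px] := eqVneq (2 * p.2) 1.
  have p2E : p.2 = 1 / 2 by lra.
  left; rewrite [p]surjective_pairing /=; congr pair => //.
  have p1n0 : p.1 + s / 2 != 0 by lra.
  by apply: (mulIf p1n0); rewrite p2E in pE; lra.
have [py|py] := eqVneq (p.1 + p.2) 1; last by case: np; exact: That_domE.
right; rewrite [p]surjective_pairing /=.
have p2E : p.2 = 2 / 3.
  have p20 : p.2 != 0 by lra.
  by apply: (mulfI p20); nra.
by congr pair; lra.
Qed.

(** The rational parametrization of the ellipse by the slope [t] of the line through (-1, 0). *)
Definition pi4_inv t : R * R :=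
  ((1 - 2 * t ^+ 2) / (1 + 2 * t ^+ 2), 2 * t / (1 + 2 * t ^+ 2)).

Lemma I4P t : I4 t <-> 0 < t /\ t < s / 2.
Proof. by rewrite /I4 /= in_itv/= invr_sqrt2; split=> [/andP[]|[-> ->]]. Qed.

Lemma I4_sqr_lt t : I4 t -> 2 * t ^+ 2 < 1.
Proof.
by move=> /I4P[t0 t1]; have [ss s1 s2] := sqrt2_bounds; rewrite expr2; nra.
Qed.

Lemma pi4_homeomorphism : homeomorphism (@FA R) (@I4 R) (@pi4 R) pi4_inv.
Proof.
have den0 t : 0 < 1 + 2 * t ^+ 2.
  by rewrite ltr_pwDl// mulr_ge0// sqr_ge0.
split.
- move=> [x y] [/Q_eq0]; rewrite !vec3E !expr2 /= => xyE [x0 y0].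
  have [ss s1 s2] := sqrt2_bounds.
  have x1 : 0 < x + 1 by lra.
  split; first apply/I4P.
    rewrite /pi4 /= divr_gt0// ltr_pdivrMr//; split=> //.
    (* Compare squares: [(2y)^2 = 2(1-x)(1+x)] is less than [2(x+1)^2]. *)
    have uu : s * (x + 1) * (s * (x + 1)) = 2 * (x + 1) * (x + 1).
      by rewrite mulrACA ss mulrA.
    have u0 : 0 < s * (x + 1) by rewrite mulr_gt0//; lra.
    suff : 2 * y < s * (x + 1) by lra.
    move: (s * (x + 1)) uu u0 => u uu u0.
    by rewrite ltNge; apply/negP => ?; nra.
  rewrite /pi4_inv /pi4 /=.
  have x1n : x + 1 != 0 by rewrite gt_eqF.
  have y2 : 2 * y ^+ 2 = (1 - x) * (1 + x) by rewrite expr2; lra.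
  have D : (x + 1) ^+ 2 + 2 * y ^+ 2 = 2 * (x + 1) by rewrite y2; ring.
  have t2 : 2 * (y / (x + 1)) ^+ 2 = (1 - x) / (1 + x).
    by rewrite expr_div_n mulrA y2; field; lra.
  rewrite t2; congr pair; field; lra.
- move=> t It; have /I4P[t0 _] := It; have t1 := I4_sqr_lt It.
  have D := den0 t.
  split.
    split; last by rewrite /= !divr_gt0// ?mulr_gt0// subr_gt0.
    rewrite /conic /Q /= !vec3E; apply/eqP; rewrite subr_eq0; apply/eqP.
    by field; rewrite gt_eqF.
  by rewrite /pi4 /=; field; rewrite gt_eqF//=; lra.
- apply: continuous_in_subspaceT => p; rewrite inE => -[_ [p1 _]].
  apply: cvgM; first exact: cvg_snd.
  by apply: cvgV; [lra|apply: cvgD; [exact: cvg_fst|exact: cvg_cst]].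
- apply: continuous_in_subspaceT => t _.
  have D : 1 + 2 * t ^+ 2 != 0 by rewrite gt_eqF.
  have c2 : (fun t : R => 2 * t ^+ 2) x @[x --> t] --> 2 * t ^+ 2.
    by apply: cvgM; [exact: cvg_cst|exact: exprn_continuous].
  have cD : (1 + 2 * x ^+ 2)^-1 @[x --> t] --> (1 + 2 * t ^+ 2)^-1.
    by apply: cvgV => //; apply: cvgD => //; exact: cvg_cst.
  have c1 : (1 - 2 * x ^+ 2) / (1 + 2 * x ^+ 2) @[x --> t] -->
      (1 - 2 * t ^+ 2) / (1 + 2 * t ^+ 2).
    by apply: cvgM => //; apply: cvgB => //; exact: cvg_cst.
  have c3 : 2 * x / (1 + 2 * x ^+ 2) @[x --> t] --> 2 * t / (1 + 2 * t ^+ 2).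
    by apply: cvgM => //; apply: cvgM => //; exact: cvg_cst.
  exact: cvg_pair c1 c3.
Qed.

(** * Conjugacy of [T4] with the system on the conic *)

Lemma T4_domP t : T4_dom t <->
  [/\ I4 t, t != 1 - s / 2 & t != 1 / 2].
Proof.
have [ss s1 s2] := sqrt2_bounds.
rewrite /T4_dom cut4E invr_sqrt2 /= !in_itv/=.
split=> [tD|[/I4P[t0 t1] tc th]].
  suff [tI tc th] : [/\ 0 < t /\ t < s / 2, t != 1 - s / 2 & t != 1 / 2].
    by split=> //; exact/I4P.
  by case: tD => [[/andP[? ?]|/andP[? ?]]|/andP[? ?]]; (split; [split| |]); lra.
have [?|?] := ltP t (1 - s / 2); first by left; left; lra.
have [?|?] := ltP t (1 / 2); first by left; right; lra.
by right; lra.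
Qed.

Lemma finite_conjugacy :
  finite_set (@I4 R `\` [set t | [/\ T4_dom t, That_dom (pi4_inv t) &
                                     T4 t = pi4 (That (pi4_inv t))]]).
Proof.
have [ss s1 s2] := sqrt2_bounds.
apply: (@sub_finite_set _ _ ([set 1 - s / 2] `|` [set 1 / 2])); last first.
  by rewrite finite_setU; split; exact: finite_set1.
move=> t [It nt]; apply: contrapT => /not_orP[/eqP tc /eqP th]; apply: nt.
have dt : T4_dom t by apply/T4_domP.
have [hF _ _ _] := pi4_homeomorphism.
have [_ hI _ _] := pi4_homeomorphism; have [Fp _] := hI _ It.
have /I4P[t0 t1] := It; have t2 := I4_sqr_lt It.
have D0 : 0 < 1 + 2 * t ^+ 2 by rewrite ltr_pwDl// mulr_ge0// sqr_ge0.
have D0n : 1 + 2 * t ^+ 2 != 0 by rewrite gt_eqF.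
(* On the interval the numerators of the two sign quantities vanish exactly at the cuts [1 - s/2]
   and [1/2]. *)
have xE : 2 * (pi4_inv t).2 - 1 = (4 * t - 1 - 2 * t ^+ 2) / (1 + 2 * t ^+ 2).
  by rewrite /=; field.
have yE : (pi4_inv t).1 + (pi4_inv t).2 - 1 =
    2 * t * (1 - 2 * t) / (1 + 2 * t ^+ 2) by rewrite /=; field.
have zE : 2 - (pi4_inv t).1 - 2 * (pi4_inv t).2 =
    (1 - 4 * t + 6 * t ^+ 2) / (1 + 2 * t ^+ 2) by rewrite /=; field.
have z0 : 0 < 1 - 4 * t + 6 * t ^+ 2.
  by have := sqr_ge0 (t - 1 / 3); rewrite !expr2; lra.
(* The image under [pi4] is the second entry over the sum of the first and third; the common
   denominator [1 + 2t^2] cancels. *)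
have cut i : 0 < xsign i * (4 * t - 1 - 2 * t ^+ 2) ->
    0 < ysign i * (1 - 2 * t) -> 
    T4 t = ysign i * (2 * t * (1 - 2 * t)) /
      (xsign i * (4 * t - 1 - 2 * t ^+ 2) + (1 - 4 * t + 6 * t ^+ 2)) ->
    That_dom (pi4_inv t) /\ T4 t = pi4 (That (pi4_inv t)).
  move=> xi yi Ti; have ci : cyl R i (pi4_inv t).
    apply/cylP; rewrite xE yE; split=> //; rewrite mulrA divr_gt0//.
    rewrite [X in 0 < X](_ : _ = 2 * t * (ysign i * (1 - 2 * t))); last by ring.
    by rewrite mulr_gt0// mulr_gt0.
  split; first by exists i.
  rewrite (That_cyl ci) Ti pi4_proj Ninv_mul !vec3E mulr1; last first.
    by rewrite zE gt_eqF// divr_gt0.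
  rewrite xE yE zE [ysign i * (_ / _)]mulrA [xsign i * (_ / _)]mulrA -mulrDl invf_div.
  by rewrite [RHS]mulrA divfK.
suff [? ?] : That_dom (pi4_inv t) /\ T4 t = pi4 (That (pi4_inv t)) by [].
(* From left to right the three intervals belong to [N3], [N2] and [N1]. *)
have [tlec|cltt] := leP t (1 - s / 2).
  apply: (cut 2%:R); rewrite /xsign /ysign /=; [nra|nra|].
  rewrite /T4 cut4E ifT; last by rewrite lt_neqAle tc tlec.
  by field; apply/andP; split; nra.
have [tleh|hltt] := leP t (1 / 2).
  apply: (cut 1); rewrite /xsign /ysign /=; [nra|nra|].
  rewrite /T4 cut4E ifF; last by apply/negbTE; rewrite -leNgt ltW.
  rewrite ifT; last by rewrite lt_neqAle -[2^-1]mul1r th tleh.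
  by field; apply/andP; split; nra.
apply: (cut 0); rewrite /xsign /ysign /=; [nra|nra|].
rewrite /T4 cut4E ifF; last by apply/negbTE; rewrite -leNgt ltW.
rewrite ifF; last by apply/negbTE; rewrite -leNgt -[2^-1]mul1r ltW.
by field; apply/andP; split; nra.
Qed.

End real.

(** * Measures of intervals *)

(** The masses may tend to infinity as [p] tends to 0, as they do for [mu4], so uniqueness from a
    class stable under intersection is applied with an exhaustion that keeps away from 0 on the
    right. *)
Lemma measure_unique_gt0 (R : realType)
    (m1 m2 : {measure set (measurableTypeR R) -> \bar R}) :
  m1 `]-oo, 0]%classic = 0%E -> m2 `]-oo, 0]%classic = 0%E ->
  (forall p : R, 0 < p -> m1 `]p, +oo[%classic = m2 `]p, +oo[%classic) ->
  (forall p : R, 0 < p -> (m1 `]p, +oo[%classic < +oo)%E) ->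
  forall A, measurable A -> m1 A = m2 A.
Proof.
move=> m10 m20 m12 m1oo.
pose P : set R := `]0, +oo[%classic.
(* Only the trace on the positive axis is prescribed, since both measures vanish on the rest. *)
pose G := [set A : set (measurableTypeR R) | measurable A /\
  (A `&` P = set0 \/ exists2 p, 0 < p & A `&` P = `]p, +oo[%classic)].
have mP : measurable (P : set (measurableTypeR R)) by exact: measurable_itv.
have restrict_gt0 (m : {measure set (measurableTypeR R) -> \bar R}) A :
    measurable A -> m `]-oo, 0]%classic = 0%E -> m A = m (A `&` P).
  move=> mA m0; rewrite -{1}(setIT A) -(setUv P) setIUr measureU//; last 3 first.
  - exact: measurableI.
  - by apply: measurableI => //; exact: measurableC.
  - by rewrite setIACA setICr setI0.
  rewrite [X in (_ + X)%E](_ : _ = 0%E) ?adde0//.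
  apply: (subset_measure0 _ _ _ m0).
  - by apply: measurableI => //; exact: measurableC.
  - exact: measurable_itv.
  - by rewrite /P setCitvr; exact: subIsetr.
pose g (k : nat) : set R := `]-oo, 0]%classic `|` `]k.+1%:R^-1, +oo[%classic.
have Gg k : G (g k).
  split; first by apply: measurableU; exact: measurable_itv.
  right; exists k.+1%:R^-1 => //; rewrite /g /P setIUl.
  rewrite [X in X `|` _](_ : _ = set0) ?set0U; last first.
    by apply/seteqP; split=> // x []; rewrite /= !in_itv/= andbT; lra.
  apply/setIidPl => x; rewrite /= !in_itv/= !andbT; apply: lt_trans.
  by rewrite invr_gt0.
apply: (measure_unique G g).
- apply/seteqP; split; last first.
    by apply: smallest_sub; [exact: smallest_sigma_algebra|move=> ? []].
  rewrite [X in X `<=` _]RGenOInfty.measurableE.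
  apply: smallest_sub; first exact: smallest_sigma_algebra.
  have GP p : 0 < p -> G `]p, +oo[%classic.
    move=> p0; split; first exact: measurable_itv.
    right; exists p => //; apply/setIidPl => x.
    by rewrite /P /= !in_itv/= !andbT => /(lt_trans p0).
  move=> _ [p ->]; have [p0|p0] := ltP 0 p.
    by apply: sub_sigma_algebra; exact: GP.
  (* For [p <= 0] the half-line is not in [G], but it is a countable union of members. *)
  have -> : `]p, +oo[%classic =
      `]p, 0]%classic `|` \bigcup_k `]k.+1%:R^-1, +oo[%classic :> set R.
    apply/seteqP; split=> x; rewrite /= !in_itv/= ?andbT.
      move=> px; have [x0|x0] := leP x 0; first by left; rewrite px.
      right; exists (Num.truncn x^-1) => //; rewrite /= in_itv/= andbT.
      by rewrite invf_plt ?posrE// truncnS_gt.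
    move=> [/andP[]//|[k _]]; rewrite /= in_itv/= andbT; apply: lt_trans.
    by rewrite (le_lt_trans p0)// invr_gt0.
  apply: (@measurableU _ (g_sigma_algebraType G)).
    apply: sub_sigma_algebra; split; first exact: measurable_itv.
    by left; apply/seteqP; split=> // x []; rewrite /P /= !in_itv/= andbT; lra.
  apply: (@bigcup_measurable _ (g_sigma_algebraType G)) => k _.
  by apply: sub_sigma_algebra; apply: GP; rewrite invr_gt0.
- move=> A B [mA hA] [mB hB]; split; first exact: measurableI.
  have -> : A `&` B `&` P = (A `&` P) `&` (B `&` P) by rewrite setIACA setIid.
  case: hA => [->|[p p0 ->]]; first by left; rewrite set0I.
  case: hB => [->|[q q0 ->]]; first by left; rewrite setI0.
  right; exists (Num.max p q); first by rewrite lt_max p0.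
  by apply/seteqP; split=> x; rewrite /= !in_itv/= !andbT gt_max;
    [case=> -> ->|move/andP].
- exact: Gg.
- apply/seteqP; split=> // x _; have [x0|x0] := leP x 0.
    by exists 0%N => //; left; rewrite /= in_itv.
  exists (Num.truncn x^-1) => //; right; rewrite /= in_itv/= andbT.
  by rewrite invf_plt ?posrE// truncnS_gt.
- move=> A [mA hA]; rewrite (restrict_gt0 m1)// (restrict_gt0 m2)//.
  by case: hA => [->|[p p0 ->]]; rewrite ?measure0// m12.
- move=> k; have [mg [g0|[p p0 gp]]] := Gg k.
    by rewrite (restrict_gt0 m1)// g0 measure0.
  by rewrite (restrict_gt0 m1)// gp m1oo.
Qed.

Section mu4.
Context {R : realType}.
Local Notation s := (Num.sqrt 2 : R).
Local Notation c := (1 - Num.sqrt 2 / 2 : R).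
Local Notation b := (Num.sqrt 2 / 2 : R).
Local Notation mu := (@mu4 R).
Local Notation lambda := (@lebesgue_measure R).

Lemma mu4_null A : measurable A -> lambda A = 0%E -> mu A = 0%E.
Proof.
move=> mA A0; apply: null_set_integral => //.
apply/measurable_funTS/measurableT_comp => //; exact: measurable_density4.
Qed.

Lemma density4E t : density4 t =
  if (0 < t) && (t < c) then (t * (1 - t))^-1
  else if (c < t) && (t < b) then t^-1 else 0.
Proof.
rewrite /density4 !indicE !mem_setE !in_itv/= cut4E invr_sqrt2.
have [/andP[t0 tc]|_] := ifP.
  have -> : (c < t < b) = false by apply/negbTE; lra.
  by rewrite mul1r mul0r addr0.
by rewrite mul0r add0r; case: ifP => _; rewrite ?mul0r ?mul1r.
Qed.

Lemma integral_FTC_oo (f H : R -> R) x y : x <= y ->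
  (forall t, t \in `[x, y] -> {for t, continuous f}) ->
  (forall t, t \in `[x, y] -> is_derive t 1 H (f t)) ->
  (\int[lambda]_(t in `]x, y[%classic) (f t)%:E = (H y - H x)%:E)%E.
Proof.
rewrite le_eqVlt => /predU1P[<-|xy] cf dH.
  by rewrite set_itvoo0 ?integral_set0 ?subrr.
have cfw : {within `[x, y]%classic, continuous f}.
  by apply: continuous_in_subspaceT => t /set_mem; exact: cf.
have mf : measurable_fun `[x, y]%classic f by exact: subspace_continuous_measurable_fun.
rewrite integral_itv_obnd_cbnd; last first.
  apply/measurable_EFinP; apply: measurable_funS mf => //.
  exact: subset_itv_oo_cc.
rewrite integral_itv_bndo_bndc; last first.
  apply/measurable_EFinP; apply: measurable_funS mf => //.
  exact: subset_itv_co_cc.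
rewrite (continuous_FTC2 xy cfw (F := H)) ?EFinB//.
- have cH t : t \in `[x, y] -> {for t, continuous H}.
    by move=> /dH tH; apply: differentiable_continuous; apply/derivable1_diffP.
  split.
  + by move=> t /subset_itv_oo_cc /dH [].
  + by apply: cvg_at_right_filter; apply: cH; rewrite in_itv/= lexx ltW.
  + by apply: cvg_at_left_filter; apply: cH; rewrite in_itv/= lexx ltW.
- move=> t /subset_itv_oo_cc /dH tH; rewrite derive1E; exact: derive_val.
Qed.

Lemma mu4_itv1 (x y : R) : 0 < x -> x <= y -> y <= c ->
  mu `]x, y[%classic = ((ln y - ln (1 - y)) - (ln x - ln (1 - x)))%:E.
Proof.
move=> x0 xy yc; have [ss s1 s2] := @sqrt2_bounds R.
transitivity (\int[lambda]_(t in `]x, y[%classic) (t^-1 + (1 - t)^-1)%:E)%E.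
  apply: eq_integral.
  move=> t; rewrite inE/= in_itv/= => /andP[xt ty].
  rewrite density4E ifT; last by lra.
  by congr EFin; field; apply/andP; split; lra.
apply: (integral_FTC_oo (H := fun t => ln t - ln (1 - t))) => //.
- move=> t; rewrite in_itv/= => /andP[xt ty].
  apply: cvgD; apply: cvgV; [lra|exact: cvg_id|lra|].
  by apply: cvgB; [exact: cvg_cst|exact: cvg_id].
- move=> t; rewrite in_itv/= => /andP[xt ty].
  have t0 : 0 < t by lra.
  have t1 : 0 < 1 - t by lra.
  have dln := is_derive1_ln t0.
  have dln1 := is_derive1_ln t1.
  have d1 : is_derive t 1 (fun u : R => 1 - u) (0 - 1) by exact: is_deriveB.
  have dc := @is_derive1_comp _ (@ln R) (fun u : R => 1 - u) t _ _ dln1 d1.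
  have -> : t^-1 + (1 - t)^-1 = t^-1 - (1 - t)^-1 * (0 - 1) by ring.
  exact: is_deriveB.
Qed.

Lemma mu4_itv2 (x y : R) : c <= x -> x <= y -> y <= b ->
  mu `]x, y[%classic = (ln y - ln x)%:E.
Proof.
move=> cx xy yb; have [ss s1 s2] := @sqrt2_bounds R.
transitivity (\int[lambda]_(t in `]x, y[%classic) (t^-1)%:E)%E.
  apply: eq_integral.
  move=> t; rewrite inE/= in_itv/= => /andP[xt ty].
  by rewrite density4E ifF ?ifT//; lra.
apply: (integral_FTC_oo (H := @ln R)) => //.
- move=> t; rewrite in_itv/= => /andP[xt ty].
  by apply: cvgV => //; lra.
- by move=> t; rewrite in_itv/= => /andP[xt ty]; apply: is_derive1_ln; lra.
Qed.

End mu4.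

(** * Dynamics of T4 *)

Section T4.
Context {R : realType}.
Implicit Types t u x y : R.
Local Notation s := (Num.sqrt 2 : R).
Local Notation c := (1 - Num.sqrt 2 / 2 : R).
Local Notation b := (Num.sqrt 2 / 2 : R).
Local Notation mu := (@mu4 R).
Local Notation lambda := (@lebesgue_measure R).
Local Notation T := (@T4 R).
Local Notation X := (always_defined (@T4_dom R) (@T4 R)).

Lemma T4E1 t : t < c -> T t = t / (1 - 2 * t).
Proof. by move=> tc; rewrite /T4 cut4E tc. Qed.

Lemma T4E2 t : c < t -> t < 1 / 2 -> T t = 1 / (2 * t) - 1.
Proof.
move=> ct th; rewrite /T4 cut4E ifF; last by apply/negbTE; lra.
by rewrite ifT//; lra.
Qed.

Lemma T4E3 t : 1 / 2 < t -> T t = 1 - 1 / (2 * t).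
Proof.
move=> ht; have [ss s1 s2] := @sqrt2_bounds R.
rewrite /T4 cut4E ifF; last by apply/negbTE; lra.
by rewrite ifF//; apply/negbTE; lra.
Qed.

(** Each case expresses [t] by the inverse branch at [T t] and records the range of [T t]. The third
    branch reaches only the part below [c]; the other two are onto. *)
Variant T4_dom_spec t : Prop :=
| T4_dom1 of 0 < t & t < c & t = T t / (1 + 2 * T t) & 0 < T t & T t < b
| T4_dom2 of c < t & t < 1 / 2 & t = 1 / (2 * (1 + T t)) & 0 < T t & T t < b
| T4_dom3 of 1 / 2 < t & t < b & t = 1 / (2 * (1 - T t)) & 0 < T t & T t < c.

Lemma T4_dom_cases t : T4_dom t -> T4_dom_spec t.
Proof.
have [ss s1 s2] := @sqrt2_bounds R.
move=> /T4_domP[/I4P[t0 tb] tc th].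
have [tc'|ct] := ltP t c.
  have Tt := T4E1 tc'.
  have d0 : 0 < 1 - 2 * t by lra.
  apply: T4_dom1; rewrite ?Tt//.
  - by field; lra.
  - by rewrite divr_gt0.
  - by rewrite ltr_pdivrMr//; nra.
have {}ct : c < t by rewrite lt_neqAle eq_sym tc.
have [th'|ht] := ltP t (1 / 2).
  have Tt := T4E2 ct th'.
  apply: T4_dom2; rewrite ?Tt//.
  - by field; lra.
  - by rewrite subr_gt0 ltr_pdivlMr ?mulr_gt0//; lra.
  - by rewrite ltrBlDr ltr_pdivrMr ?mulr_gt0//; nra.
have {}ht : 1 / 2 < t by rewrite lt_neqAle eq_sym th.
have Tt := T4E3 ht.
apply: T4_dom3; rewrite ?Tt//.
- by field; lra.
- by rewrite subr_gt0 ltr_pdivrMr ?mulr_gt0//; lra.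
- by rewrite ltrBlDr -ltrBlDl ltr_pdivlMr ?mulr_gt0//; nra.
Qed.

Lemma T4_I4 t : T4_dom t -> I4 (T t).
Proof.
have [ss s1 s2] := @sqrt2_bounds R.
by move=> /T4_dom_cases[? ? _ ? ?|? ? _ ? ?|? ? _ ? ?]; apply/I4P; lra.
Qed.

Lemma T4_branch1 u : I4 u ->
  T4_dom (u / (1 + 2 * u)) /\ T (u / (1 + 2 * u)) = u.
Proof.
move=> /I4P[u0 ub]; have [ss s1 s2] := @sqrt2_bounds R.
have d0 : 0 < 1 + 2 * u by lra.
have tc : u / (1 + 2 * u) < c by rewrite ltr_pdivrMr//; nra.
have t0 : 0 < u / (1 + 2 * u) by rewrite divr_gt0.
split; first by apply/T4_domP; split; [apply/I4P|..]; lra.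
by rewrite T4E1//; field; apply/andP; split; lra.
Qed.

Lemma T4_branch2 u : I4 u ->
  T4_dom (1 / (2 * (1 + u))) /\ T (1 / (2 * (1 + u))) = u.
Proof.
move=> /I4P[u0 ub]; have [ss s1 s2] := @sqrt2_bounds R.
have d0 : 0 < 2 * (1 + u) by lra.
have ct : c < 1 / (2 * (1 + u)) by rewrite ltr_pdivlMr//; nra.
have th : 1 / (2 * (1 + u)) < 1 / 2 by rewrite ltr_pdivrMr//; lra.
split; first by apply/T4_domP; split; [apply/I4P|..]; lra.
by rewrite T4E2//; field; lra.
Qed.

Lemma T4_branch3 u : 0 < u -> u < c ->
  T4_dom (1 / (2 * (1 - u))) /\ T (1 / (2 * (1 - u))) = u.
Proof.
move=> u0 uc; have [ss s1 s2] := @sqrt2_bounds R.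
have d0 : 0 < 2 * (1 - u) by lra.
have ht : 1 / 2 < 1 / (2 * (1 - u)) by rewrite ltr_pdivlMr//; lra.
have tb : 1 / (2 * (1 - u)) < b by rewrite ltr_pdivrMr//; nra.
split; first by apply/T4_domP; split; [apply/I4P|..]; lra.
by rewrite T4E3//; field; lra.
Qed.

(** * Points with an infinite orbit, and measurability *)

Lemma defined_T4_dom t : X t -> T4_dom t.
Proof. by move=> /(_ 0%N). Qed.

Lemma defined_I4 t : X t -> I4 t.
Proof. by move=> /defined_T4_dom/T4_domP[]. Qed.

Lemma definedP t : X t <-> T4_dom t /\ X (T t).
Proof.
split=> [Xt|[Dt XTt] [|n]//]; last by rewrite iterSr; exact: XTt.
by split=> [|n]; [exact: defined_T4_dom|rewrite -iterSr; exact: Xt].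
Qed.

Lemma countable_undefined : countable (@I4 R `\` X).
Proof.
(* The set [N n] contains all points that reach one of the two cuts after [n] steps; it is built
   from the three inverse branches. *)
pose N := fix N n : set R := if n is n.+1 then
    \bigcup_(u in N n)
      [set u / (1 + 2 * u); 1 / (2 * (1 + u)); 1 / (2 * (1 - u))]
  else [set c; 1 / 2].
have cN n : countable (N n).
  elim: n => [|n IHn] /=; last apply: bigcup_countable => // u _;
    by apply: finite_set_countable; rewrite !finite_setU; do !split; exact: finite_set1.
apply: (@sub_countable _ _ _ (\bigcup_n N n)); last exact: bigcup_countable.
apply: subset_card_le => t [It nXt].
have [n nD] : exists n, ~ T4_dom (iter n T t) by apply/existsNP.
elim: n t It nD {nXt} => [|n IHn] t It nD.
  exists 0%N => //=; apply: contrapT => /not_orP[/eqP tc /eqP th].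
  by apply: nD; apply/T4_domP.
have [Dt|nDt] := pselect (T4_dom t); last first.
  exists 0%N => //=; apply: contrapT => /not_orP[/eqP tc /eqP th].
  by apply: nDt; apply/T4_domP.
have [m _ Nm] : (\bigcup_n N n) (T t).
  by apply: IHn; [exact: T4_I4|rewrite -iterSr].
exists m.+1 => //; exists (T t) => //=; case: (T4_dom_cases Dt) => _ _ tE _ _.
- by left; left.
- by left; right.
- by right.
Qed.

Lemma lebesgue_undefined : lambda (@I4 R `\` X) = 0%E.
Proof. exact/countable_lebesgue_measure0/countable_undefined. Qed.

Lemma measurable_T4_dom : measurable (@T4_dom R : set (measurableTypeR R)).
Proof. by apply: measurableU; [apply: measurableU|]; exact: measurable_itv. Qed.

Lemma measurable_T4 : measurable_fun [set: measurableTypeR R] T.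
Proof.
have mt : measurable_fun [set: measurableTypeR R] (@id R) by exact: measurable_id.
have m2t : measurable_fun [set: measurableTypeR R] (fun t : R => 2 * t).
  exact: measurable_funM.
have mi : measurable_fun [set: measurableTypeR R] (fun t : R => 1 / (2 * t)).
  apply: measurable_funM => //.
  exact: (measurableT_comp (@measurable_invr R)).
apply: measurable_fun_ifT.
- by apply: measurable_fun_ltr.
- apply: measurable_funM => //.
  apply: (measurableT_comp (@measurable_invr R)).
  by apply: measurable_funB.
apply: measurable_fun_ifT.
- by apply: measurable_fun_ltr.
- by apply: measurable_funB.
- by apply: measurable_funB.
Qed.

Lemma measurable_iter_T4 n :
  measurable_fun [set: measurableTypeR R]
    (iter n T : measurableTypeR R -> measurableTypeR R).
Proof.
elim: n => [|n IHn]; first exact: measurable_id.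
exact: measurableT_comp measurable_T4 IHn.
Qed.

Lemma measurable_defined : measurable (X : set (measurableTypeR R)).
Proof.
have -> : X = \bigcap_n (iter n T @^-1` @T4_dom R).
  by apply/seteqP; split=> [t Xt n _|t Xt n]; exact: Xt.
apply: bigcap_measurable => // n _; rewrite -[X in measurable X]setTI.
by apply: measurable_iter_T4 => //; exact: measurable_T4_dom.
Qed.

(** The mass of the half-line above [p]. For [p < c] the contributions at the cut cancel because
    [1 - c = b]. *)
Definition mu4_tail (p : R) : R :=
  if p < c then ln (1 - p) - ln p else if p < b then ln b - ln p else 0.

Lemma mu4_set1 t : mu [set t] = 0%E.
Proof. by apply: mu4_null; [exact: measurable_set1|exact: lebesgue_measure_set1]. Qed.

Lemma mu4_outside A : measurable A -> A `<=` ~` @I4 R -> mu A = 0%E.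
Proof.
move=> mA AI; apply: integral0_eq => t /AI nt.
rewrite density4E; have [ss s1 s2] := @sqrt2_bounds R.
rewrite ifF; last by apply/negbTE/negP => ?; apply: nt; apply/I4P; lra.
by rewrite ifF//; apply/negbTE/negP => ?; apply: nt; apply/I4P; lra.
Qed.

Lemma mu4_tailE (p : R) : 0 < p -> mu `]p, +oo[%classic = (mu4_tail p)%:E.
Proof.
move=> p0; have [ss s1 s2] := @sqrt2_bounds R.
have after_b q : 0 < q -> b <= q -> mu `]q, +oo[%classic = 0%E.
  move=> q0 bq; apply: mu4_outside; first exact: measurable_itv.
  by move=> t; rewrite /= in_itv/= andbT => qt /I4P[_]; lra.
have split_at q r : q < r ->
    mu `]q, +oo[%classic = (mu `]q, r[%classic + mu `]r, +oo[%classic)%E.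
  move=> qr.
  have -> : `]q, +oo[%classic = (`]q, r[ `|` [set r]) `|` `]r, +oo[ :> set R.
    apply/seteqP; split=> t /=; rewrite !in_itv/= !andbT.
      by case: (ltgtP t r) => [tr|rt|->] qt; [left; left; rewrite qt|right|left; right].
    by move=> [[/andP[]//|->//]|]; exact: lt_trans.
  rewrite measureU/=; last 3 first.
  - by apply: measurableU; [exact: measurable_itv|exact: measurable_set1].
  - exact: measurable_itv.
  - apply/seteqP; split=> // t [[|->]]; rewrite /= !in_itv/= ?ltxx//.
    by rewrite andbT => /andP[_ tr] rt; have := lt_trans tr rt; rewrite ltxx.
  rewrite measureU/=; last 3 first.
  - exact: measurable_itv.
  - exact: measurable_set1.
  - apply/seteqP; split=> // t [/= + tr].
    by rewrite tr in_itv/= ltxx andbF.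
  by rewrite mu4_set1 adde0.
have tail2 q : c <= q -> q < b -> mu `]q, +oo[%classic = (ln b - ln q)%:E.
  have b0 : 0 < b by lra.
  move=> cq qb; rewrite (split_at _ _ qb) (after_b _ b0 (lexx _)) adde0.
  by rewrite mu4_itv2// ltW.
rewrite /mu4_tail; have [pc|cp] := ltP p c.
  rewrite (split_at _ _ pc) mu4_itv1 ?(ltW pc)// tail2//; last by lra.
  rewrite -EFinD; congr EFin.
  have -> : 1 - c = b by ring.
  by ring.
by have [pb|bp] := ltP p b; [exact: tail2|exact: after_b].
Qed.

(** The first and third branches increase and the second decreases; the third takes only values
    below [c], hence its condition [p < c]. *)
Lemma T4_preimage_itv (p : R) : 0 < p -> p < b ->
  @T4_dom R `&` T @^-1` `]p, +oo[%classic =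
  `]p / (1 + 2 * p), c[ `|` `]c, 1 / (2 * (1 + p))[
    `|` [set t | [/\ p < c, 1 / (2 * (1 - p)) < t & t < b]].
Proof.
move=> p0 pb; have [ss s1 s2] := @sqrt2_bounds R.
apply/seteqP; split=> t.
  move=> [/T4_dom_cases + ]; rewrite /= !in_itv/= andbT => -[].
  - move=> t0 tc tE T0 Tb pT; left; left; rewrite tc andbT tE.
    rewrite ltr_pdivrMr; last by lra.
    by rewrite mulrAC ltr_pdivlMr; nra.
  - move=> ct th tE T0 Tb pT; left; right; rewrite ct /= tE.
    rewrite ltr_pdivrMr; last by lra.
    by rewrite mulrAC ltr_pdivlMr; nra.
  - move=> ht tb tE T0 Tc pT; right; split=> //; first lra.
    rewrite tE ltr_pdivrMr; last by lra.
    by rewrite mulrAC ltr_pdivlMr; nra.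
have d1 : 0 < 1 + 2 * p by lra.
have d2 : 0 < 2 * (1 + p) by lra.
have d3 : 0 < 2 * (1 - p) by lra.
have p1 : 0 < p / (1 + 2 * p) by rewrite divr_gt0.
have p2 : 1 / (2 * (1 + p)) < 1 / 2 by rewrite ltr_pdivrMr//; lra.
have p3 : 1 / 2 < 1 / (2 * (1 - p)) by rewrite ltr_pdivlMr//; lra.
move=> [[|]|[pc pt tb]]; rewrite /= ?in_itv/= ?andbT.
- move=> /andP[pt tc]; split.
    by apply/T4_domP; split; [apply/I4P|..]; lra.
  move: pt; rewrite T4E1// ltr_pdivrMr// ltr_pdivlMr; last by lra.
  by lra.
- move=> /andP[ct tp]; split.
    by apply/T4_domP; split; [apply/I4P|..]; lra.
  have th : t < 1 / 2 by lra.
  move: tp; rewrite T4E2// ltrBrDr ltr_pdivlMr// ltr_pdivlMr; last by lra.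
  by lra.
- split; first by apply/T4_domP; split; [apply/I4P|..]; lra.
  have ht : 1 / 2 < t by lra.
  move: pt; rewrite T4E3// ltr_pdivrMr// ltrBrDr -ltrBrDl ltr_pdivrMr; last by lra.
  by lra.
Qed.

(** * Invariance *)

(** The terms in [ln (1 + p)] from the first two branches cancel and leave [ln b - ln p]. For
    [p < c] the third branch adds [ln (1 - p) - ln b]. *)
Lemma mu4_T4_preimage_itv (p : R) : 0 < p ->
  mu (@T4_dom R `&` T @^-1` `]p, +oo[%classic) = (mu4_tail p)%:E.
Proof.
move=> p0; have [ss s1 s2] := @sqrt2_bounds R.
have [pb|bp] := ltP p b; last first.
  rewrite [X in mu X](_ : _ = set0).
    rewrite measure0 /mu4_tail ifF; last by apply/negbTE; lra.
    by rewrite ifF//; apply/negbTE; lra.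
  apply/seteqP; split=> // t [/T4_I4/I4P[_ Tb]].
  by rewrite /= in_itv/= andbT; lra.
have d1 : 0 < 1 + 2 * p by lra.
have d2 : 0 < 2 * (1 + p) by lra.
have d3 : 0 < 2 * (1 - p) by lra.
have p1 : 0 < p / (1 + 2 * p) by rewrite divr_gt0.
have p1c : p / (1 + 2 * p) <= c by rewrite ler_pdivrMr//; nra.
have p2 : 1 / (2 * (1 + p)) < 1 / 2 by rewrite ltr_pdivrMr//; lra.
have cp2 : c <= 1 / (2 * (1 + p)) by rewrite ler_pdivlMr//; nra.
have p3 : 1 / 2 < 1 / (2 * (1 - p)) by rewrite ltr_pdivlMr//; lra.
rewrite T4_preimage_itv//.
set I3 := (X in _ `|` X).
have I3E : I3 = if p < c then `]1 / (2 * (1 - p)), b[%classic else set0.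
  apply/seteqP; split=> t; rewrite /I3 /=.
    by move=> [-> pt tb]; rewrite /= in_itv/= pt.
  by case: ifP => // pc; rewrite /= in_itv/= => /andP[].
have mI3 : measurable (I3 : set (measurableTypeR R)).
  by rewrite I3E; case: ifP => _ //; exact: measurable_itv.
rewrite measureU/=; last 3 first.
- by apply: measurableU; exact: measurable_itv.
- exact: mI3.
- by apply/seteqP; split=> // t [[|] + [pc pt tb]]; rewrite /= !in_itv/=; lra.
rewrite measureU/=; last 3 first.
- exact: measurable_itv.
- exact: measurable_itv.
- by apply/seteqP; split=> // t []; rewrite /= !in_itv/=; lra.
rewrite mu4_itv1// mu4_itv2//; last by lra.
have E2 : 1 - p / (1 + 2 * p) = (1 + p) * (1 + 2 * p)^-1 by field; lra.
have E3 : 1 / (2 * (1 + p)) = (2 * (1 + p))^-1 by rewrite mul1r.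
have E4 : 1 / (2 * (1 - p)) = (2 * (1 - p))^-1 by rewrite mul1r.
have E5 : 1 - c = b by ring.
(* This is [2b^2 = 1] in logarithms. *)
have E6 : ln b = - ln 2 - ln b.
  have b2 : 2 * b != 0 by lra.
  have bE : b = (2 * b)^-1 by apply: (mulIf b2); rewrite mulVf//; lra.
  have b0 : 0 < b by lra.
  by rewrite {1}bE lnV ?posrE ?mulr_gt0// lnM ?posrE// opprD.
have p10 : 0 < 1 + p by lra.
rewrite E2 E5 E3; set lb := ln b in E6 *.
rewrite (lnV (x := 2 * (1 + p))) ?posrE// !lnM ?posrE ?invr_gt0//.
rewrite /mu4_tail pb I3E -/lb; have [pc|cp] := ltP p c; last first.
  rewrite measure0 adde0 -EFinD; congr EFin.
  by rewrite [X in _ = X - _]E6; ring.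
have p3b : 1 / (2 * (1 - p)) <= b by rewrite ler_pdivrMr//; nra.
rewrite mu4_itv2//; last by lra.
rewrite -!EFinD; congr EFin.
have p11 : 0 < 1 - p by lra.
by rewrite -/lb E4 (lnV (x := 2 * (1 - p))) ?posrE// lnM ?posrE//; ring.
Qed.

Lemma mu4_T4_preimage A : measurable A ->
  mu (@T4_dom R `&` T @^-1` A) = mu A.
Proof.
move=> mA.
(* Restricting to [T4_dom] before pushing forward discards the values of [T4] off its domain. *)
pose image : {measure set (measurableTypeR R) -> \bar R} :=
  @pushforward _ _ (measurableTypeR R) (measurableTypeR R) _
    (mrestr mu measurable_T4_dom) T.
pose m := image measurable_T4.
have mE B : m B = mu (@T4_dom R `&` T @^-1` B) by rewrite setIC.
rewrite -mE; apply: measure_unique_gt0 => //.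
- rewrite mE [X in mu X](_ : _ = set0) ?measure0//; apply/seteqP; split=> // t.
  by move=> [/T4_I4/I4P[T0 _]]; rewrite /= in_itv/=; lra.
- apply: mu4_outside; first exact: measurable_itv.
  by move=> t; rewrite /= in_itv/= => t0 /I4P[]; lra.
- by move=> p p0; rewrite mE mu4_T4_preimage_itv//; exact/esym/mu4_tailE.
- by move=> p p0; rewrite mE mu4_T4_preimage_itv// ltry.
Qed.

Lemma mu4_invariant : invariant_measure mu X T.
Proof.
split; first exact: measurable_funS measurable_T4.
move=> A mA AX; rewrite -[RHS](mu4_T4_preimage mA); congr (mu _).
apply/seteqP; split=> t [Xt TA]; split=> //; first exact: defined_T4_dom.
by apply/definedP; split=> //; exact: AX.
Qed.

Lemma mu4_sigma_finite : sigma_finite (@I4 R : set (measurableTypeR R)) mu.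
Proof.
have [ss s1 s2] := @sqrt2_bounds R.
exists (fun n => @I4 R `&` `]n.+1%:R^-1, +oo[%classic).
  rewrite -setI_bigcupr; apply/esym/setIidPl => t /I4P[t0 tb].
  exists (Num.truncn t^-1) => //; rewrite /= in_itv/= andbT.
  by rewrite invf_plt ?posrE// truncnS_gt.
move=> n; split; first by apply: measurableI; exact: measurable_itv.
apply: (@le_lt_trans _ _ (mu `]n.+1%:R^-1, +oo[%classic)).
  apply: le_measure; rewrite ?inE; last exact: subIsetr.
  - by apply: measurableI; exact: measurable_itv.
  - exact: measurable_itv.
by rewrite mu4_tailE ?ltry// invr_gt0.
Qed.

End T4.

(** * Inverse branches *)

(** Cover [V] by intervals. The part of [E] sent into an interval of length [l] lies in a ball of
    radius [l / k], which has length [2 * l / k]; this is the source of the factor [k / 2]. *)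
Lemma expanding_lebesgue_measure (R : realType) (phi : R -> R) (k : R)
    (E V : set (measurableTypeR R)) :
  measurable E -> measurable V -> 0 < k -> phi @` E `<=` V ->
  {in E &, forall u v, k * `|u - v| <= `|phi u - phi v|} ->
  ((k / 2)%:E * lebesgue_measure E <= lebesgue_measure V)%E.
Proof.
move=> mE mV k0 EV expand.
apply: le_ereal_inf_tmp => _ [A [oA VA] <-].
have /choice[B HB] : forall j, exists Bj : set (measurableTypeR R),
    [/\ measurable Bj, E `&` phi @^-1` A j `<=` Bj &
        ((k / 2)%:E * lebesgue_measure Bj <= wlength idfun (A j))%E].
  move=> j.
  have [[u [Eu Au]]|noE] := pselect (exists u, E u /\ A j (phi u)); last first.
    exists set0; split=> //; first by move=> u [Eu Au]; apply: noE; exists u.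
    by rewrite measure0 mule0; exact: (@wlength_ge0 _ idfun).
  have [[x y] /= _ Axy] := oA j.
  move: Au; rewrite -Axy /= in_itv/= => /andP[xu uy].
  have xy : x <= y by rewrite ltW// (lt_le_trans xu).
  exists (ball u ((y - x) / k)); split.
  - exact: measurable_ball.
  - move=> v [Ev]; rewrite /= in_itv/= => /andP[xv vy].
    rewrite /ball/= ltr_pdivlMr// mulrC.
    rewrite (le_lt_trans (expand _ _ _ _)) ?inE// ltr_norml; lra.
  - have r0 : 0 <= (y - x) / k by rewrite divr_ge0 ?subr_ge0// ltW.
    rewrite lebesgue_measure_ball// wlength_itv_bnd// -EFinM lee_fin /=.
    have -> // : k / 2 * ((y - x) / k *+ 2) = y - x.
    by rewrite mulr2n; field; rewrite gt_eqF.
have EB : E `<=` \bigcup_j B j.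
  move=> u Eu; have [j _ Aj] := VA (phi u) (EV _ (imageP phi Eu)).
  by exists j => //; have [_ + _] := HB j; apply.
apply: (@le_trans _ _ ((k / 2)%:E * \sum_(j <oo) lebesgue_measure (B j))%E).
  rewrite lee_pmul2l//; last by rewrite lte_fin divr_gt0.
  by apply: measure_sigma_subadditive => // j; have [] := HB j.
rewrite -nneseriesZl; last by move=> j _; exact: measure_ge0.
apply: lee_nneseries => [j _ _|j _]; last by have [] := HB j.
by rewrite mule_ge0 ?lee_fin ?divr_ge0// ltW.
Qed.

(** * Moebius maps *)

Definition moebius (R : fieldType) (p q r d u : R) : R := (p * u + q) / (r * u + d).

Lemma moebius_sub (R : fieldType) (p q r d u v : R) :
  r * u + d != 0 -> r * v + d != 0 ->
  moebius p q r d u - moebius p q r d v =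
  (p * d - q * r) * (u - v) / ((r * u + d) * (r * v + d)).
Proof. by move=> u0 v0; rewrite /moebius; field; rewrite u0 v0. Qed.

Lemma moebius_comp (R : fieldType) (p q r d p' q' r' d' u : R) :
  r' * u + d' != 0 ->
  moebius p q r d (moebius p' q' r' d' u) =
  moebius (p * p' + q * r') (p * q' + q * d') (r * p' + d * r') (r * q' + d * d') u.
Proof.
move=> u0; rewrite /moebius.
have -> : p * ((p' * u + q') / (r' * u + d')) + q =
    ((p * p' + q * r') * u + (p * q' + q * d')) / (r' * u + d') by field.
have -> : r * ((p' * u + q') / (r' * u + d')) + d =
    ((r * p' + d * r') * u + (r * q' + d * d')) / (r' * u + d') by field.
by rewrite invf_div mulrA divfK.
Qed.

Section ergodicity.
Context {R : realType}.
Implicit Types t u x y : R.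
Local Notation s := (Num.sqrt 2 : R).
Local Notation c := (1 - Num.sqrt 2 / 2 : R).
Local Notation b := (Num.sqrt 2 / 2 : R).
Local Notation mu := (@mu4 R).
Local Notation lambda := (@lebesgue_measure R).
Local Notation T := (@T4 R).
Local Notation X := (always_defined (@T4_dom R) (@T4 R)).

(** Only full branches are considered: the right inverse of the iterate lives on all of [X]. *)
Definition inverse_branch (n : nat) (phi : R -> R) : Prop :=
  forall u, X u -> X (phi u) /\ iter n T (phi u) = u.

Lemma inverse_branch_comp n m phi psi :
  inverse_branch n phi -> inverse_branch m psi ->
  inverse_branch (m + n) (phi \o psi).
Proof.
move=> hphi hpsi u Xu; have [Xpsi psiK] := hpsi _ Xu.
by have [Xphi phiK] := hphi _ Xpsi; rewrite iterD /= phiK.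
Qed.

Lemma inverse_branch1 : inverse_branch 1 (fun u : R => u / (1 + 2 * u)).
Proof.
move=> u Xu; have [Du Tu] := T4_branch1 (defined_I4 Xu).
by split=> //; apply/definedP; rewrite Tu.
Qed.

Lemma inverse_branch2 : inverse_branch 1 (fun u : R => 1 / (2 * (1 + u))).
Proof.
move=> u Xu; have [Du Tu] := T4_branch2 (defined_I4 Xu).
by split=> //; apply/definedP; rewrite Tu.
Qed.

(** The values of [u / (1 + 2u)] lie below [c], where the inverse of the third branch is defined. *)
Lemma inverse_branch31 :
  inverse_branch 2 (fun u : R => 1 / (2 * (1 - u / (1 + 2 * u)))).
Proof.
move=> u Xu; have [Xv vu] := inverse_branch1 Xu.
have /I4P[u0 ub] := defined_I4 Xu; have [ss s1 s2] := @sqrt2_bounds R.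
set v := u / (1 + 2 * u) in Xv vu *.
have v0 : 0 < v by rewrite divr_gt0//; lra.
have vc : v < c by rewrite ltr_pdivrMr; [nra|lra].
have [Dw Tw] := T4_branch3 v0 vc.
by split; [apply/definedP; rewrite Tw|rewrite (iterD 1 1) /= Tw].
Qed.

Lemma eq_inverse_branch n phi psi :
  (forall u, X u -> phi u = psi u) -> inverse_branch n phi -> inverse_branch n psi.
Proof. by move=> e h u Xu; rewrite -e//; exact: h. Qed.

(* First-passage branches: the orbit leaves (0, c), then takes the second
   branch, or the third one followed by the first, whose composite is onto. *)
Lemma jump_branch x : X x -> exists n p q r d, exists2 u, X u &
  [/\ x = moebius p q r d u, inverse_branch n.+1 (moebius p q r d),
      (0 <= p <= 2 * q) && (0 <= r <= 2 * d), 2 <= d &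
      `|p * d - q * r| = 2].
Proof.
have [ss s1 s2] := @sqrt2_bounds R.
(* On the first branch [1 / T x = 1 / x - 2], so a bound [N] on [1 / x] can be lowered at each step;
   this drives the induction. *)
have [N xN] : exists N : nat, X x -> 1 <= N%:R * x.
  exists (Num.truncn x^-1).+1 => /defined_I4/I4P[x0 _].
  by rewrite -ler_pdivrMr// mul1r ltW// truncnS_gt.
move=> Xx; move/(_ Xx) : xN; elim: N x Xx => [|N IHN] x Xx xN.
  by rewrite mul0r in xN; lra.
have XTx : X (T x) by case/definedP : Xx.
case: (T4_dom_cases (defined_T4_dom Xx)) =>
  [x0 xc xE T0 Tb|cx xh xE T0 Tb|hx xb xE T0 Tc].
- have [|n [p [q [r [d [u Xu branch]]]]]] := IHN (T x) XTx.
    rewrite T4E1//; rewrite mulrA ler_pdivlMr; last lra.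
    by move: xN; rewrite -natr1; lra.
  have [uE hu /andP[/andP[p0 pq] /andP[r0 rd]] d2 det] := branch.
  have /I4P[u0 ub] := defined_I4 Xu.
  (* Composing with [u / (1 + 2u)] adds twice the top row of coefficients to the bottom row, which
     preserves the determinant and the inequalities. *)
  have qE v : X v -> moebius p q r d v / (1 + 2 * moebius p q r d v) =
     moebius p q (2 * p + r) (2 * q + d) v.
    move=> /defined_I4/I4P[v0 vb].
    have vd : r * v + d != 0 by rewrite gt_eqF// ltr_wpDl//; [nra|lra].
    have := moebius_comp 1 0 2 1 p q vd; rewrite /moebius !mul1r !mul0r !addr0.
    by rewrite [1 + _]addrC => ->.
  exists n.+1, p, q, (2 * p + r), (2 * q + d), u => //; split.
  + by rewrite {1}xE uE qE.
  + apply: (eq_inverse_branch qE); rewrite -addn1.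
    exact: (inverse_branch_comp inverse_branch1 hu).
  + lra.
  + lra.
  + by rewrite -det; congr `| _ |; ring.
- exists 0%N, 0, 1, 2, 2, (T x) => //; have E v : 1 / (2 * (1 + v)) = moebius 0 1 2 2 v.
    by rewrite /moebius mul0r add0r mulrDr mulr1 addrC.
  split=> //.
  + by rewrite -E.
  + by apply: (eq_inverse_branch _ inverse_branch2) => v _; exact: E.
  + lra.
  + by rewrite mul0r mul1r sub0r normrN ger0_norm.
- have XTTx : X (T (T x)) by case/definedP : XTx.
  have E v : X v -> 1 / (2 * (1 - v / (1 + 2 * v))) = moebius 2 1 2 2 v.
    move=> /defined_I4/I4P[v0 vb]; rewrite /moebius; field.
    by apply/andP; split; lra.
  (* Since [T x < c], the first branch comes next. *)
  have TE : T x = T (T x) / (1 + 2 * T (T x)).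
    by case: (T4_dom_cases (defined_T4_dom XTx)) => [//|cTx|hTx]; lra.
  exists 1%N, 2, 1, 2, 2, (T (T x)) => //; split=> //.
  + by rewrite -E// -TE.
  + exact: (eq_inverse_branch E inverse_branch31).
  + lra.
  + by rewrite (_ : 2 * 2 - 1 * 2 = 2) ?ger0_norm//; ring.
Qed.

(* The bound r <= 2 d makes the distortion of the branch uniformly bounded. *)
Lemma contracting_branch k x : X x -> exists n p q r d, exists2 u, X u &
  [/\ x = moebius p q r d u, inverse_branch n (moebius p q r d),
      (k <= n)%N, 0 < d /\ 0 <= r <= 2 * d &
      0 < `|p * d - q * r| /\ 2 ^+ k * `|p * d - q * r| <= d ^+ 2].
Proof.
move=> Xx; elim: k => [|k [n [p [q [r [d [u Xu branch]]]]]]].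
  exists 0%N, 1, 0, 0, 1, x => //.
  have E v : v = moebius 1 0 0 1 v by rewrite /moebius mul0r mul1r add0r addr0 divr1.
  split=> //; last by rewrite mulr0 subr0 mulr1 normr1 expr0 expr1n mulr1.
  - by move=> v Xv; rewrite -E.
  - by split=> //; lra.
have [xE hx kn [d0 /andP[r0 rd]] [det0 det]] := branch.
have [m [p' [q' [r' [d' [v Xv jump]]]]]] := jump_branch Xu.
have [uE hu /andP[/andP[p0' pq'] /andP[r0' rd']] d2' det'] := jump.
have cE w : X w -> moebius p q r d (moebius p' q' r' d' w) =
    moebius (p * p' + q * r') (p * q' + q * d') (r * p' + d * r') (r * q' + d * d') w.
  move=> /defined_I4/I4P[w0 wb]; apply: moebius_comp.
  by rewrite gt_eqF// ltr_wpDl//; [nra|lra].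
have detE : `|(p * p' + q * r') * (r * q' + d * d') -
      (p * q' + q * d') * (r * p' + d * r')| = 2 * `|p * d - q * r|.
  by rewrite -det' -normrM; congr `| _ |; ring.
exists (m.+1 + n)%N; do 4 eexists; exists v => //; split.
- by rewrite xE uE cE.
- exact: (eq_inverse_branch cE (inverse_branch_comp hx hu)).
- by rewrite addSn ltnS (leq_trans kn)// leq_addl.
(* The bounds [p' <= 2q'] and [r' <= 2d'] of the jump carry [r <= 2d] over to the composite. *)
- by split; [nra|apply/andP; split; nra].
- rewrite detE; split; first by rewrite mulr_gt0.
  (* The lower right coefficient at least doubles, so its square gains a factor 4 while the
     determinant doubles: a net contraction by 2 per jump. *)
  have dd : 2 * d <= r * q' + d * d' by nra.
  rewrite exprSr -mulrA mulrCA; apply: (@le_trans _ _ ((2 * d) ^+ 2)).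
    rewrite exprMn; nra.
  by rewrite ler_pXn2r ?nnegrE//; nra.
Qed.

(** * Recurrence *)

Definition visits (K : nat) (E : set R) : set R :=
  [set t | X t /\ exists2 n, (K <= n)%N & E (iter n T t)].

Lemma measurable_visits K (E : set (measurableTypeR R)) :
  measurable E -> measurable (visits K E : set (measurableTypeR R)).
Proof.
move=> mE.
have -> : visits K E = X `&` \bigcup_(n in [set n | (K <= n)%N]) (iter n T @^-1` E).
  by apply/seteqP; split=> [t [Xt [n Kn En]]|t [Xt [n Kn En]]]; split=> //; exists n.
apply: measurableI; first exact: measurable_defined.
apply: bigcup_measurable => n _; rewrite -[X in measurable X]setTI.
exact: measurable_iter_T4.
Qed.

(** With [D] the absolute determinant, [d <= r u + d <= 3 d] puts the difference quotients of the
    branch between [D / (9 d^2)] and [D / d^2]. The upper bound places the image of [E] in the ball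
    of radius [rho = D / d^2] about [x], and the lower one bounds its measure. *)
Lemma visits_ball k K E x : X x -> measurable (E : set (measurableTypeR R)) ->
  E `<=` X -> (K <= k)%N ->
  exists rho : R, [/\ 0 < rho, rho <= 2^-1 ^+ k &
    ((rho / 18)%:E * lambda E <= lambda (visits K E `&` ball x rho))%E].
Proof.
move=> Xx mE EX Kk; have [ss s1 s2] := @sqrt2_bounds R.
have [n [p [q [r [d [v Xv [xE hx kn [d0 /andP[r0 rd]] [det0 det]]]]]]]] :=
  contracting_branch k Xx.
set D := `|p * d - q * r| in det0 det.
have dd : 0 < d ^+ 2 by rewrite exprn_gt0.
have denom u : X u -> d <= r * u + d <= 3 * d.
  by move=> /defined_I4/I4P[u0 ub]; apply/andP; split; nra.
have sub u w : X u -> X w -> `|moebius p q r d u - moebius p q r d w| =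
    D * `|u - w| / ((r * u + d) * (r * w + d)).
  move=> Xu Xw; have /andP[du _] := denom _ Xu; have /andP[dw _] := denom _ Xw.
  have u0 : 0 < r * u + d by lra.
  have w0 : 0 < r * w + d by lra.
  rewrite moebius_sub ?gt_eqF// 2!normrM normfV [X in _ / X]gtr0_norm//.
  by rewrite mulr_gt0.
exists (D / d ^+ 2); split.
- by rewrite divr_gt0.
- rewrite ler_pdivrMr// exprVn mulrC ler_pdivlMr ?exprn_gt0//.
  by rewrite mulrC.
(* The 18 is the distortion constant 9 times the covering factor 2. *)
have -> : D / d ^+ 2 / 18 = D / (9 * d ^+ 2) / 2 by field; rewrite gt_eqF.
apply: (@expanding_lebesgue_measure _ (moebius p q r d)) => //.
- by apply: measurableI; [exact: measurable_visits|exact: measurable_ball].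
- by rewrite divr_gt0// mulr_gt0.
- move=> _ [u Eu <-]; have Xu := EX _ Eu; have [Xpu puK] := hx _ Xu.
  split; first by split=> //; exists n; [exact: leq_trans Kk kn|rewrite puK].
  rewrite /ball/= {1}xE sub//.
  have /andP[du _] := denom _ Xu; have /andP[dv _] := denom _ Xv.
  rewrite ltr_pdivrMr; last by rewrite mulr_gt0//; lra.
  rewrite mulrAC ltr_pdivlMr//.
  have vu : `|v - u| < 1.
    move: (defined_I4 Xu) (defined_I4 Xv) => /I4P[? ?] /I4P[? ?].
    by rewrite ltr_norml; lra.
  rewrite -mulrA ltr_pM2l//.
  apply: (@lt_le_trans _ _ (1 * d ^+ 2)); first by rewrite ltr_pM2r.
  by rewrite mul1r expr2 ler_pM// ltW.
- move=> u w; rewrite !inE => /EX Xu /EX Xw; rewrite sub//.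
  have /andP[du du3] := denom _ Xu; have /andP[dw dw3] := denom _ Xw.
  have -> : D / (9 * d ^+ 2) * `|u - w| = D * `|u - w| / (9 * d ^+ 2) by rewrite mulrAC.
  apply: ler_pM => //; first by rewrite mulr_ge0// ltW.
    by rewrite invr_ge0 mulr_ge0// ltW.
  rewrite lef_pV2 ?posrE ?mulr_gt0//; [|lra..].
  have -> : 9 * d ^+ 2 = (3 * d) * (3 * d) by ring.
  by apply: ler_pM => //; lra.
Qed.

(** By Lebesgue's theorem, almost every point outside [visits K E] has density 0 for that set,
    whereas around each point of [X] arbitrarily small balls contain a fixed proportion of it. *)
Lemma lebesgue_visits K (E : set (measurableTypeR R)) :
  measurable E -> E `<=` X -> lambda E != 0%E ->
  lambda (X `\` visits K E) = 0%E.
Proof.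
move=> mE EX E0; have [ss s1 s2] := @sqrt2_bounds R.
have mV := measurable_visits K mE; have mX := measurable_defined.
have Eoo : (lambda E < +oo)%E.
  apply: (@le_lt_trans _ _ (lambda `[0, 1]%classic)).
    apply: le_measure; rewrite ?inE//.
    by move=> t /EX/defined_I4/I4P[t0 t1]; rewrite /= in_itv/=; lra.
  by rewrite lebesgue_measure_itv/= lte_fin ltr01 sube0 ltry.
have [e e0 Ee] : exists2 e : R, 0 < e & lambda E = e%:E.
  exists (fine (lambda E)); last by rewrite fineK// ge0_fin_numE.
  by apply: fine_gt0; rewrite Eoo andbT lt0e E0 measure_ge0.
have [Z [mZ Z0 VZ]] := lebesgue_density mV.
apply: (subset_measure0 _ mZ) => //; first exact: measurableD.
move=> x [Xx nVx]; apply: VZ => /=; rewrite indicE memNset// => cvg0.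
(* The proportion is [(rho / 18) * e] over the length [2 * rho] of the ball. *)
have e36 : ((false%:R : R)%:E < (e / 36)%:E)%E by rewrite lte_fin divr_gt0.
have [dl /= dl0 small] := cvg0 _ (open_ereal_lt' (y := (e / 36)%:E) e36).
(* Then [k >= K] and [2 ^ k > 1 / dl], so the radius falls below [dl]. *)
pose k := (K + (Num.truncn dl^-1).+1)%N.
have [rho [rho0 rhok le1]] := visits_ball Xx mE EX (leq_addr _ K : (K <= k)%N).
have rhodl : rho < dl.
  apply: (le_lt_trans rhok); rewrite exprVn invf_plt ?posrE ?exprn_gt0//.
  apply: (lt_trans (truncnS_gt _)); rewrite -natrX ltr_nat.
  by rewrite (leq_ltn_trans (leq_addl K _))// ltn_expl.
have := small rho; rewrite /= sub0r normrN gtr0_norm// => /(_ rhodl rho0).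
rewrite lebesgue_measure_ball ?ltW// inver mulrn_eq0/= gt_eqF//.
rewrite lte_pdivrMr ?mulrn_wgt0// -EFinM => /(le_lt_trans le1).
rewrite Ee -EFinM lte_fin mulr2n; lra.
Qed.

(** * Ergodicity and conservativity *)

Lemma mu4_gt0_lebesgue (E : set (measurableTypeR R)) : measurable E ->
  mu E != 0%E -> lambda E != 0%E.
Proof. by move=> mE; apply: contra_neq => /(mu4_null mE). Qed.

(** A point whose orbit meets an invariant set already lies in it, so [visits 0 A] is [A] itself,
    and it has full measure once [A] is not null. *)
Lemma mu4_ergodic : ergodic mu X T.
Proof.
move=> A mA AX TA; have [A0|A0] := eqVneq (mu A) 0%E; [by left|right].
apply: mu4_null; first by apply: measurableD => //; exact: measurable_defined.
have := lebesgue_visits 0 mA AX (mu4_gt0_lebesgue mA A0).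
congr (lambda (X `\` _) = _); apply/seteqP; split=> [t [Xt [n _]]|t At].
  elim: n t Xt => //= n IHn t Xt; rewrite -iterS iterSr => ATn.
  by rewrite -TA; split=> //; apply: IHn => //; case/definedP : Xt.
by split; [exact: AX|exists 0%N].
Qed.

(** Almost every point visits [W] at arbitrarily large times, hence at two different times [n < m],
    and so lies in two of the preimages. Disjointness would put all of [W] in the exceptional null
    set. *)
Lemma mu4_conservative : conservative mu X T.
Proof.
move=> [W [mW WX W0 tW]].
have lW0 : lambda W != 0%E by apply: mu4_gt0_lebesgue => //; rewrite gt_eqF.
have X0 : lambda (X `\` \bigcap_K visits K W) = 0%E.
  rewrite setDE setC_bigcap setI_bigcupr.
  have mV K := measurable_visits K mW.
  have mD K : measurable (X `&` ~` visits K W : set (measurableTypeR R)).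
    by apply: measurableI; [exact: measurable_defined|exact: measurableC].
  apply/negligibleP; first exact: bigcup_measurable.
  by apply: negligible_bigcup => K; apply/negligibleP => //; exact: lebesgue_visits.
have W_le : (lambda W <= lambda (X `\` \bigcap_K visits K W))%E.
  apply: le_measure; rewrite ?inE//.
    apply: measurableD; first exact: measurable_defined.
    by apply: bigcap_measurable => // K _; exact: measurable_visits.
  move=> t /WX Xt; split=> // VK.
  have [_ [n _ Wn]] := VK 0%N Logic.I.
  have [_ [m nm Wm]] := VK n.+1 Logic.I.
  have /trivIsetP /(_ n m Logic.I Logic.I) := tW.
  rewrite (ltn_eqF nm) => /(_ isT) /seteqP[/(_ t) + _]; apply.
  by split; split.
by move: lW0; rewrite eq_le measure_ge0 andbT -X0 W_le.
Qed.

End ergodicity.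

Theorem theorem1p5 (R : realType) :
  (* (1) *)
  (matrix_generating_system N base (@Q int) F /\
   (forall v : 'cV[int]_3, F v -> Q v = 0 ->
     [/\ F (N2 *m v) /\ Q (N2 *m v) = 0,
         F (N3 *m v) /\ Q (N3 *m v) = 0,
         Q (N1 *m v) = 0 &
         F (N1 *m v) <->
           (v 2%:R 0)%:~R / Num.sqrt 2 < (v 0 0)%:~R :> R])) /\
  (* (2) *)
  ([/\ forall (i : 'I_3) (v : 'cV[R]_3), Q (NR R i *m v) = Q v,
       trivIset setT (cyl R),
       finite_set (@FA R `\` @That_dom R) &
       exists piinv : R -> R * R,
         homeomorphism (@FA R) (@I4 R) (@pi4 R) piinv /\
         finite_set (@I4 R `\` [set t | [/\ T4_dom t, That_dom (piinv t) &
                                          T4 t = pi4 (That (piinv t))]])]) /\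
  (* (3) *)
  (let X := always_defined (@T4_dom R) (@T4 R) in
   [/\ @lebesgue_measure R (@I4 R `\` X) = 0%E,
       sigma_finite (@I4 R : set (measurableTypeR R)) (@mu4 R),
       invariant_measure (@mu4 R) X (@T4 R),
       ergodic (@mu4 R) X (@T4 R) &
       conservative (@mu4 R) X (@T4 R)]).
Proof.
split; first by split; [exact: generating_system|move=> v; exact: N_restriction].
split.
  split; [exact: Q_mapN|exact: trivIset_cyl|exact: finite_FA_That_dom|].
  by exists pi4_inv; split; [exact: pi4_homeomorphism|exact: finite_conjugacy].
split; [exact: lebesgue_undefined|exact: mu4_sigma_finite|exact: mu4_invariant| |].
- exact: mu4_ergodic.
- exact: mu4_conservative.
Qed.
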